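(* For any integer $d\ge 2$ there exists a constant $C>0$ such that for every sufficiently large prime power $q$ the following holds. If $X\subseteq \mathbb{F}_q^d$ with $|X|=n\ge Cq$, then there is a collection $\mathcal{S}$ of coplanar $(d+1)$-sets in $X$ such that (i) $|\mathcal{S}|\ge \frac{1}{C}\, n^{d+1}q^{-1}$; (ii) $\Delta_j(\mathcal{S})\le C\, n^{d+1-j}\, q^{-\frac{d+1-j}{d}}$ for every $1\le j\le d+1$.
   Context: $\mathbb{F}_q$ is the finite field with $q$ elements. A $k$-flat of $\mathbb{F}_q^d$ is a $k$-dimensional affine subspace. A coplanar $k$-set is a set of $k$ points contained in some $(k-2)$-flat; so a coplanar $(d+1)$-set is a set of $d+1$ distinct points contained in some $(d-1)$-flat (affine hyperplane). For a collection $\mathcal{S}$ of $(d+1)$-subsets of $X$ and $1\le j\le d+1$, $\Delta_j(\mathcal{S})$ denotes the maximum, over all $j$-element subsets $D\subseteq X$, of the number of members of $\mathcal{S}$ containing $D$. The threshold for ''sufficiently large'' depends only on $d$. *)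

(* Defs.v *)
From mathcomp Require Import all_boot all_order all_algebra.

Set Implicit Arguments.
Unset Strict Implicit.
Unset Printing Implicit Defensive.

Import GRing.Theory.
Local Open Scope ring_scope.

Definition is_flat (F : finFieldType) (d k : nat) (A : {set 'rV[F]_d}) : Prop :=
  exists (p : 'rV[F]_d) (V : {vspace 'rV[F]_d}),
    \dim V = k /\ A = [set p + v | v in V].

(* The truncated subtraction is harmless: the notion is only meant for k >= 2. *)
Definition coplanar_set (F : finFieldType) (d k : nat) (S : {set 'rV[F]_d}) :
    Prop :=
  #|S| = k /\ exists A : {set 'rV[F]_d}, is_flat (k - 2) A /\ S \subset A.

(* The maximum is 0 when X has no j-element subset. *)
Definition max_codegree (T : finType) (X : {set T}) (j : nat)
    (S : {set {set T}}) : nat :=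
  \max_(D : {set T} | (D \subset X) && (#|D| == j))
     #|[set s in S | D \subset s]|.

(* Main.v *)
(** Take a maximal family S of coplanar (d+1)-subsets of X in which every set D
    with 1 <= |D| <= d lies in at most n^(d+1-|D|)/q members.  If S is too small,
    then the saturated sets D, together with S itself, form a sparse family G, and
    it suffices to find a coplanar (d+1)-set of X containing no member of G: it
    could be added to S.

    If a positive proportion of the d-tuples of X is dependent, extend such tuples
    by an arbitrary point.  Otherwise look for hyperplanes W and sets U(W) of
    points of W such that U(W) has at most a small proportion of its points in any
    smaller flat, while a positive proportion of the d-tuples v is contained in
    U(span v).  Choosing such a v and then another point of U(span v), every
    d-tuple of coordinates is distributed almost as evenly as v, so G is avoided
    with positive probability.

    To find these hyperplanes, start with a random d-tuple: its span contains at
    least a constant times n/q points.  Passing to smaller flats that contain a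
    positive proportion of these points yields such a system U in some rank r <= d.
    To raise the rank, span two flats of rank r that share r-1 of the coordinates,
    and remove from the new flat W, one by one, the smaller flats that contain a
    large part of what is left.  Boundedly many removals hit few of the tuples
    since U is spread out in flats of rank r; and only few tuples avoid all
    removed flats when very little of W is left, because one of the coordinates
    can be exchanged for an arbitrary point of W. *)
Require Import Defs.
From mathcomp Require Import all_boot all_order all_algebra.
From mathcomp Require Import reals exp.
From mathcomp Require Import boolp ring lra zify.

Set Implicit Arguments.
Unset Strict Implicit.
Unset Printing Implicit Defensive.

Import Order.TTheory GRing.Theory Num.Theory.
Local Open Scope ring_scope.

(** * Exchanging coordinates *)

Section Update.
Variables (T I : finType).
Implicit Types (v : {ffun I -> T}) (k : I) (w : T).

Definition upd v k w : {ffun I -> T} := [ffun i => if i == k then w else v i].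

Lemma upd_same v k w : upd v k w k = w.
Proof. by rewrite ffunE eqxx. Qed.

Lemma upd_other v k w i : i != k -> upd v k w i = v i.
Proof. by move=> /negPf ik; rewrite ffunE ik. Qed.

Lemma updK v k w : upd (upd v k w) k (v k) = v.
Proof. by apply/ffunP => i; rewrite !ffunE; case: eqVneq => [->|]. Qed.

Lemma sum_upd (M : nmodType) k (h : {ffun I -> T} -> T -> M) :
  \sum_v \sum_w h v w = \sum_v \sum_w h (upd v k w) (v k).
Proof.
rewrite !pair_big /=.
rewrite (reindex (fun p : {ffun I -> T} * T => (upd p.1 k p.2, p.1 k))) //=.
by exists (fun p : {ffun I -> T} * T => (upd p.1 k p.2, p.1 k)) => -[v w] _ /=;
  rewrite updK upd_same.
Qed.

(* Double counting of the pairs (v, w) with w in E v: exchanging w with the k-th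
   coordinate of v turns them into pairs counted from the new tuple. *)
Lemma resample (R : realFieldType) (A P : {set {ffun I -> T}}) k
    (E : {ffun I -> T} -> {set T}) (u : {ffun I -> T} -> nat) (a b : R) :
    0 <= b ->
    (forall v, v \in A -> (0 < u v)%N /\ a * (u v)%:R <= #|E v|%:R) ->
    (forall v w, v \in A -> w \in E v -> upd v k w \in P /\ u (upd v k w) = u v) ->
    (forall v, v \in P ->
       #|[set w | (upd v k w \in A) && (v k \in E (upd v k w))]|%:R <=
         b * (u v)%:R) ->
  a * #|A|%:R <= b * #|P|%:R.
Proof.
move=> b0 EA AP PE.
(* The weight [1 / u v] is unchanged by the exchange: each [v] in [A] contributes at least [a]
   before it, each [v] in [P] at most [b] after it. *)
pose h v w : R := if (v \in A) && (w \in E v) then (u v)%:R^-1 else 0.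
have lo : a * #|A|%:R <= \sum_v \sum_w h v w.
  rewrite mulrC mulr_natl -sumr_const big_mkcond /=; apply: ler_sum => v _.
  case: ifPn => vA; last first.
    by rewrite big1 // => w _; rewrite /h (negPf vA).
  have [u0 Ev] := EA _ vA.
  rewrite (eq_bigr (fun w => if w \in E v then (u v)%:R^-1 else 0)); last first.
    by move=> w _; rewrite /h vA.
  rewrite -big_mkcond /= sumr_const -[_ *+ _]mulr_natr mulrC ler_pdivlMr ?ltr0n //.
apply: le_trans lo _; rewrite (sum_upd k) [leRHS]mulrC mulr_natl -sumr_const.
rewrite [leRHS]big_mkcond /=; apply: ler_sum => v _.
case: ifPn => vP; last first.
  rewrite big1 // => w _; rewrite /h; case: ifP => // /andP[wA wE].
  by case/negP: vP; have [] := AP _ _ wA wE; rewrite updK.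
rewrite (eq_bigr (fun w => if w \in [set w | (upd v k w \in A) &&
    (v k \in E (upd v k w))] then (u v)%:R^-1 else 0)); last first.
  move=> w _; rewrite /h inE; case: ifP => // /andP[wA wE].
  by have [_] := AP _ _ wA wE; rewrite updK => <-.
rewrite -big_mkcond /= sumr_const -[_ *+ _]mulr_natr mulrC.
(* For [u v = 0] the default value [0^-1 = 0] kills the weights. *)
have [u0|u0] := posnP (u v); first by rewrite u0 invr0 mulr0.
by rewrite ler_pdivrMr ?ltr0n // PE.
Qed.

End Update.

(** * Spans of tuples *)

Section Span.
Variables (F : fieldType) (V : vectType F) (T I : finType) (f : T -> V).
Implicit Types (v : {ffun I -> T}) (J : {set I}) (W H : {vspace V}).

Definition sp J v : {vspace V} := (\sum_(j in J) <[f (v j)]>)%VS.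
Definition indep J v := \dim (sp J v) == #|J|.
Definition pts W : {set T} := [set t | f t \in W].

Lemma mem_sp J v j : j \in J -> f (v j) \in sp J v.
Proof.
move=> jJ; rewrite /sp (bigD1 j) //=; apply: (subvP (addvSl _ _)).
exact: memv_line.
Qed.

Lemma sp_subv J v W : (forall j, j \in J -> f (v j) \in W) -> (sp J v <= W)%VS.
Proof. by move=> vW; apply/subv_sumP => j jJ; rewrite -memvE vW. Qed.

Lemma eq_sp J v v' : {in J, v =1 v'} -> sp J v = sp J v'.
Proof. by move=> vv'; apply: eq_bigr => j jJ; rewrite vv'. Qed.

Lemma spS J J' v : J \subset J' -> (sp J v <= sp J' v)%VS.
Proof. by move=> /subsetP JJ'; apply: sp_subv => j /JJ'; apply: mem_sp. Qed.

Lemma sp0 v : sp set0 v = 0%VS.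
Proof. by rewrite /sp big_set0. Qed.

Lemma sp_setU1 J v k : k \notin J -> sp (k |: J) v = (<[f (v k)]> + sp J v)%VS.
Proof. by move=> kJ; rewrite /sp big_setU1. Qed.

Lemma sp_setD1 J v k : k \in J -> sp J v = (<[f (v k)]> + sp (J :\ k) v)%VS.
Proof. by move=> kJ; rewrite -{1}(setD1K kJ) sp_setU1 // !inE eqxx. Qed.

Lemma dim_sp J v : (\dim (sp J v) <= #|J|)%N.
Proof.
rewrite -sum1_card /sp; elim/big_ind2: _ => [|W1 n1 W2 n2 le1 le2|j _].
- by rewrite dimv0.
- exact: leq_trans (leq_of_leqif (dimv_add_leqif _ _)) (leq_add le1 le2).
- by rewrite dim_vline; case: (_ == _).
Qed.

Lemma indepS J J' v : J \subset J' -> indep J' v -> indep J v.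
Proof.
move=> JJ' /eqP ind; rewrite /indep eqn_leq dim_sp /=.
have spE : sp J' v = (sp J v + sp (J' :\: J) v)%VS.
  rewrite /sp (big_setID J) /=; congr (_ + _)%VS.
  by apply: eq_bigl => j; rewrite (setIidPr JJ').
have := leq_trans (leq_of_leqif (dimv_add_leqif (sp J v) (sp (J' :\: J) v)))
   (leq_add (leqnn _) (dim_sp (J' :\: J) v)).
rewrite -spE ind cardsD (setIidPr JJ').
have := subset_leq_card JJ'; lia.
Qed.

Lemma indep_setD1 J v k : k \in J -> indep J v -> ~~ (sp J v <= sp (J :\ k) v)%VS.
Proof.
move=> kJ ind; have ind' := indepS (subD1set J k) ind.
apply/negP => /dimvS; rewrite (eqP ind) (eqP ind') (cardsD1 k J) kJ; lia.
Qed.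

Lemma indep_inj J v : indep J v -> {in J &, injective v}.
Proof.
move=> ind i j iJ jJ vij; apply/eqP/negPn/negP => ij.
case/negP: (indep_setD1 jJ ind); apply: sp_subv => l lJ.
have [->|lj] := eqVneq l j; last by apply: mem_sp; rewrite !inE lj.
by rewrite -vij; apply: mem_sp; rewrite !inE ij.
Qed.

Lemma upd_sp_sub J v k w : f w \in sp J v -> (sp J (upd v k w) <= sp J v)%VS.
Proof.
move=> fw; apply: sp_subv => j jJ; rewrite ffunE.
by case: eqP => // _; apply: mem_sp.
Qed.

Lemma upd_indep J v k w : f w \in sp J v -> indep J v -> indep J (upd v k w) ->
  sp J (upd v k w) = sp J v.
Proof.
move=> fw /eqP iv /eqP iw; apply/eqP; rewrite eqEdim upd_sp_sub //= iv iw.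
by [].
Qed.

Lemma sp_upd_out J v k w : k \notin J -> sp J (upd v k w) = sp J v.
Proof.
by move=> kJ; apply: eq_sp => j jJ; rewrite upd_other //; apply: contraNneq kJ => <-.
Qed.

Lemma upd_indep_out J v k w : k \in J -> indep J v -> f w \in sp J v ->
  f w \notin sp (J :\ k) v -> indep J (upd v k w).
Proof.
move=> kJ ind fw fwk; rewrite /indep eqn_leq dim_sp /=.
have := indepS (subD1set J k) ind; rewrite /indep (cardsD1 k J) kJ => /eqP <-.
rewrite (sp_setD1 _ kJ) upd_same sp_upd_out ?inE ?eqxx //=.
rewrite add1n ltnNge; apply: contra fwk => le.
have /eqP -> : sp (J :\ k) v == (<[f w]> + sp (J :\ k) v)%VS.
  by rewrite eqEdim addvSr.
by apply: (subvP (addvSl _ _)); exact: memv_line.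
Qed.

(** Steinitz exchange: as [f w] is outside [sp J1 v], it has a nonzero coefficient at some [k]
    outside [J1]. If [f w] also lay in the span omitting [k], so would [f (v k)], against
    independence. *)
Lemma exchange J J1 v w : J1 \subset J -> indep J v -> f w \in sp J v ->
  f w \notin sp J1 v -> exists2 k, k \in J :\: J1 & indep J (upd v k w).
Proof.
move=> J1J ind fw fw1.
have [/forall_inP all|] := boolP [forall k in J :\: J1, f w \in sp (J :\ k) v];
  last first.
  rewrite negb_forall_in => /exists_inP[k kJ fwk]; exists k => //.
  by apply: upd_indep_out => //; move: kJ; rewrite !inE => /andP[].
case/memv_sumP: (fw) => c cV fwE.
have [/forall_inP c0|] := boolP [forall k in J :\: J1, c k == 0].
  case/negP: fw1; rewrite fwE; apply: memv_suml => j jJ.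
  have [jJ1|jJ1] := boolP (j \in J1).
    by move: (cV _ jJ); apply/subvP; rewrite -memvE mem_sp.
  by have /c0/eqP -> : j \in J :\: J1; rewrite ?inE ?jJ1 ?jJ // mem0v.
rewrite negb_forall_in => /exists_inP[k kJ ck]; exists k => //.
have kJ' : k \in J by move: kJ; rewrite inE => /andP[].
case/negP: (indep_setD1 kJ' ind); rewrite (sp_setD1 _ kJ') subv_add subvv andbT.
have : c k \in sp (J :\ k) v.
  have -> : c k = f w - \sum_(j in J :\ k) c j.
    by rewrite fwE (big_setD1 k) //= addrK.
  apply: memvB; first exact: all.
  apply: memv_suml => j jJ; have jJ' : j \in J by move: jJ; rewrite inE => /andP[].
  by move: (cV _ jJ'); apply/subvP; rewrite -memvE mem_sp.
have /vlineP[a ca] := cV _ kJ'.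
have a0 : a != 0 by apply: contraNneq ck => a0; rewrite ca a0 scale0r.
by move/(memvZ a^-1); rewrite ca scalerA mulVf // scale1r -memvE.
Qed.

End Span.

(** * Spread-out families of flats *)

Lemma card_bigcup_le (X K : finType) (J : {set K}) (B : K -> {set X}) :
  (#|\bigcup_(k in J) B k| <= \sum_(k in J) #|B k|)%N.
Proof.
elim/big_ind2: _ => [|S1 n1 S2 n2 le1 le2|//]; first by rewrite cards0.
by rewrite (leq_trans (leq_of_leqif (leq_card_setU _ _))) ?leq_add.
Qed.

Lemma card_cover (R : realFieldType) (X K : finType) (A : {set X}) (J : {set K})
    (B : K -> {set X}) (c : R) :
    (forall x, x \in A -> exists2 k, k \in J & x \in B k) ->
    (forall k, k \in J -> #|B k|%:R <= c) ->
  #|A|%:R <= #|J|%:R * c.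
Proof.
move=> AB Bc; apply: (@le_trans _ _ (\sum_(k in J) #|B k|%:R)); last first.
  by rewrite mulr_natl -sumr_const; apply: ler_sum.
have AS : A \subset \bigcup_(k in J) B k.
  by apply/subsetP => x /AB[k kJ xk]; apply/bigcupP; exists k.
rewrite -natr_sum ler_nat.
exact: leq_trans (subset_leq_card AS) (card_bigcup_le _ _).
Qed.

Lemma card_cover2 (R : realFieldType) (X : finType) (A B1 B2 : {set X}) (c1 c2 : R) :
    A \subset B1 :|: B2 -> #|B1|%:R <= c1 -> #|B2|%:R <= c2 ->
  #|A|%:R <= c1 + c2.
Proof.
move=> /subset_leq_card AB l1 l2; apply: le_trans (lerD l1 l2).
rewrite -natrD ler_nat; apply: leq_trans AB _.
exact: leq_of_leqif (leq_card_setU _ _).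
Qed.

Section Structure.
Variables (R : realFieldType) (F : fieldType) (V : vectType F) (T I : finType).
Variable f : T -> V.
Implicit Types (v : {ffun I -> T}) (J : {set I}) (W H : {vspace V}).
Implicit Types (U : {vspace V} -> {set T}) (eta : R).

Local Notation sp := (sp f).
Local Notation indep := (indep f).
Local Notation pts := (pts f).
Local Notation N := (#|{ffun I -> T}|%:R : R).

(** For points of [W], testing every [H] that does not contain [W] amounts to testing the proper
    subspaces [W :&: H]. *)
Definition thin eta W (A : {set T}) :=
  forall H, ~~ (W <= H)%VS -> #|A :&: pts H|%:R <= eta * #|A|%:R.

Definition framed U J v := indep J v && [forall j in J, v j \in U (sp J v)].

Definition structured J (delta eta : R) :=
  exists U, [/\ forall W, U W \subset pts W, forall W, thin eta W (U W) &
    delta * N <= #|[set v | framed U J v]|%:R].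

Lemma framedP U J v :
  reflect (indep J v /\ forall j, j \in J -> v j \in U (sp J v)) (framed U J v).
Proof. by apply: (iffP andP) => -[? /forall_inP]. Qed.

Lemma few_hits U (Hs : {vspace V} -> seq {vspace V}) eta (t : nat) J J' :
    J \subset J' -> 0 <= eta -> eta <= 2^-1 ->
    (forall W, thin eta W (U W)) -> (forall W, U W \subset pts W) ->
    (forall W, (size (Hs W) <= t)%N) ->
  #|[set v | [&& indep J' v, framed U J v &
      has (fun H => ~~ (sp J v <= H)%VS && [exists j in J, f (v j) \in H])
          (Hs (sp J' v))]]|%:R <= #|J|%:R * (2 * t%:R * eta * N).
Proof.
move=> JJ' eta0 eta1 Uthin Upts Hst.
pose A j := [set v | [&& indep J' v, framed U J v &
  has (fun H => ~~ (sp J v <= H)%VS && (f (v j) \in H)) (Hs (sp J' v))]].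
apply: (@card_cover _ _ _ _ J A) => [v|j jJ].
  rewrite inE => /and3P[i1 i2 /hasP[H HH /andP[JH /exists_inP[j jJ jH]]]].
  by exists j => //; rewrite inE i1 i2; apply/hasP; exists H; rewrite ?JH.
pose E v := [set w in U (sp J v) | f w \notin sp (J :\ j) v].
have key v w : indep J' v -> indep J v -> w \in E v ->
    [/\ indep J (upd v j w), sp J (upd v j w) = sp J v &
        sp J' (upd v j w) = sp J' v].
  move=> indJ' indJ; rewrite inE => /andP[wU wE].
  have fw : f w \in sp J v by have := subsetP (Upts _) _ wU; rewrite inE.
  have ind : indep J (upd v j w) by apply: upd_indep_out.
  split => //; first exact: upd_indep.
  have fw' : f w \in sp J' v by apply: subvP fw; apply: spS.
  apply: upd_indep => //; apply: upd_indep_out => //; first exact: (subsetP JJ').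
  (* Otherwise [sp J v], spanned by [f w] and the coordinates in [J :\ j], would lie in
     [sp (J' :\ j) v], and so would [f (v j)]. *)
  apply/negP => fwJ.
  case/negP: (indep_setD1 (subsetP JJ' _ jJ) indJ').
  rewrite (sp_setD1 _ _ (subsetP JJ' _ jJ)) subv_add subvv andbT.
  have sJ : (sp J v <= sp (J' :\ j) v)%VS.
    rewrite -(upd_indep fw indJ ind) (sp_setD1 _ _ jJ) upd_same sp_upd_out ?inE ?eqxx //.
    rewrite subv_add -memvE fwJ /=; apply: spS.
    by apply/subsetP => i; rewrite !inE => /andP[-> /(subsetP JJ')].
  by rewrite -memvE (subvP sJ) // mem_sp.
have := @resample T I R (A j) setT j E (fun v => #|U (sp J v)|) 2^-1 (t%:R * eta).
rewrite cardsT => res.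
suff : 2^-1 * #|A j|%:R <= t%:R * eta * N by lra.
apply: res.
- by rewrite mulr_ge0 ?ler0n.
- move=> v; rewrite inE => /and3P[indJ' fr _]; have /framedP[indJ vU] := fr.
  split; first by apply/card_gt0P; exists (v j); apply: vU.
  have := Uthin (sp J v) _ (indep_setD1 jJ indJ).
  have -> : E v = U (sp J v) :\: pts (sp (J :\ j) v).
    by apply/setP => w; rewrite !inE andbC.
  rewrite cardsD natrB ?subset_leq_card ?subsetIl //.
  have := ler0n R #|U (sp J v)|; nra.
- move=> v w; rewrite inE => /and3P[indJ' /framedP[indJ _] _] wE.
  by have [_ -> _] := key _ _ indJ' indJ wE; rewrite inE.
- move=> v _.
  apply: (@le_trans _ _
    #|\bigcup_(H <- Hs (sp J' v) | ~~ (sp J v <= H)%VS) (U (sp J v) :&: pts H)|%:R).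
    rewrite ler_nat; apply: subset_leq_card; apply/subsetP => w.
    rewrite [in X in X -> _]inE => /andP[]; rewrite inE => /and3P[indJ' fr hs] vE.
    have /framedP[indJ wU] := fr.
    have [_] := key _ _ indJ' indJ vE; rewrite updK => e1 e2.
    move: hs (wU j jJ); rewrite -e1 -e2 upd_same => /hasP[H HH /andP[JH fwH]] wUj.
    rewrite (big_rem _ HH) /= JH /=.
    by rewrite !inE wUj fwH.
  have aux (s : seq {vspace V}) :
     #|\bigcup_(H <- s | ~~ (sp J v <= H)%VS) (U (sp J v) :&: pts H)|%:R <=
       (size s)%:R * (eta * #|U (sp J v)|%:R).
    elim: s => [|H s IH]; first by rewrite big_nil cards0 mul0r.
    rewrite big_cons /= -natr1 mulrDl mul1r.
    have nn : 0 <= eta * #|U (sp J v)|%:R by rewrite mulr_ge0 ?ler0n.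
    case: ifPn => HJ; last by apply: le_trans IH _; rewrite lerDl.
    rewrite addrC; apply: card_cover2 (subxx _) _ IH.
    exact: Uthin.
  apply: le_trans (aux _) _; rewrite -mulrA ler_wpM2r ?mulr_ge0 ?ler0n //.
  by rewrite ler_nat.
Qed.

(* In such a tuple some coordinate may be exchanged for a positive proportion of
   the points of its span, whereas the reverse exchange has few choices. *)
Lemma few_shrunk U (zeta : R) J : (forall t, f t != 0) -> J != set0 -> 0 <= zeta ->
    (forall W, U W \subset pts W) ->
  #|[set v | framed U J v &
      #|U (sp J v)|%:R <= zeta * #|pts (sp J v)|%:R]|%:R <= #|J|%:R * (#|J|%:R * (zeta * N)).
Proof.
move=> f0 J0 zeta0 Upts; have J1 : (0 < #|J|)%N by rewrite card_gt0.
pose E k v := [set w in pts (sp J v) | indep J (upd v k w)].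
pose A k := [set v | [&& framed U J v,
   #|U (sp J v)|%:R <= zeta * #|pts (sp J v)|%:R &
   (#|pts (sp J v)| <= #|J| * #|E k v|)%N]].
apply: (@card_cover _ _ _ _ J A) => [v|k kJ].
  rewrite inE => /andP[fr small]; have /framedP[ind vU] := fr.
  have [/exists_inP[k kJ le]|] := boolP [exists k in J,
    (#|pts (sp J v)| <= #|J| * #|E k v|)%N].
    by exists k => //; rewrite inE fr small.
  rewrite negb_exists_in => /forall_inP lt.
  (* By [exchange] from the empty set the [E k v] cover all points of the span, no [f w] being zero.
     If every [k] failed, integrality would leave room for at most one point less than that. *)
  have := @card_cover R _ _ (pts (sp J v)) J (fun k => E k v)
     ((#|pts (sp J v)|%:R - 1) / #|J|%:R).
  rewrite [#|J|%:R * _]mulrC divfK ?pnatr_eq0 -?lt0n // => cov.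
  suff : #|pts (sp J v)|%:R <= #|pts (sp J v)|%:R - 1 :> R by lra.
  apply: cov => [w wW|k kJ].
    have fw : f w \in sp J v by rewrite inE in wW.
    have [|k] := @exchange _ _ _ _ f J set0 v w (sub0set _) ind fw.
      by rewrite sp0 memv0.
    by rewrite setD0 => kJ indk; exists k => //; rewrite inE wW.
  rewrite ler_pdivlMr ?ltr0n // lerBrDr -natrM natr1 ler_nat mulnC.
  by have := lt _ kJ; rewrite -ltnNge.
have := @resample T I R (A k) setT k (E k) (fun v => #|pts (sp J v)|) #|J|%:R^-1 zeta.
rewrite cardsT ler_pdivrMl ?ltr0n // => res.
have inv v w : indep J v -> w \in E k v -> sp J (upd v k w) = sp J v.
  by move=> ind; rewrite !inE => /andP[fw indw]; apply: upd_indep.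
apply: res => //.
- move=> v; rewrite inE => /and3P[/framedP[ind vU] _ le]; split.
    by apply/card_gt0P; exists (v k); apply/(subsetP (Upts _))/vU.
  by rewrite mulrC ler_pdivrMr ?ltr0n // -natrM ler_nat mulnC.
- move=> v w; rewrite inE => /and3P[/framedP[ind vU] _ le] wE.
  by rewrite inE inv.
- move=> v _; set S := [set w | _].
  (* The smallness of [U] is known only through a tuple in [A k], hence the case of an empty [S]. *)
  have [->|[w0 w0S]] := set_0Vmem S; first by rewrite cards0 mulr_ge0.
  have SU w : w \in S -> w \in U (sp J v) /\
      #|U (sp J v)|%:R <= zeta * #|pts (sp J v)|%:R.
    rewrite inE inE => /andP[/and3P[/framedP[ind vU] le _] vE].
    by have := inv _ _ ind vE; rewrite updK => ->; have := vU _ kJ; rewrite upd_same.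
  apply: le_trans (SU _ w0S).2; rewrite ler_nat; apply: subset_leq_card.
  by apply/subsetP => w /SU[].
Qed.

(** While the remainder is not thin, some flat holds more than a share [eta] of it; removing that
    flat shrinks the remainder by a factor [1 - eta] or better. *)
Lemma prune eta W (t : nat) : 0 <= eta -> eta <= 1 ->
  exists Hs : seq {vspace V}, [/\ (size Hs <= t)%N, all (fun H => ~~ (W <= H)%VS) Hs &
    let A := [set x in pts W | all (fun H => f x \notin H) Hs] in
    thin eta W A \/ #|A|%:R <= (1 - eta) ^+ t * #|pts W|%:R].
Proof.
move=> eta0 eta1; elim: t => [|t [Hs [size_Hs Hs_all]]] /=.
  exists [::]; split => //; right; rewrite expr0 mul1r ler_nat.
  by apply: subset_leq_card; apply/subsetP => x; rewrite inE => /andP[].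
set A := [set x in _ | _] => HsA.
have [thinA|/existsNP[H /not_implyP[WH AH]]] := pselect (thin eta W A).
  by exists Hs; split; rewrite ?leqW //; left.
exists (H :: Hs); split => /=; rewrite ?WH //.
right; case: HsA => [/(_ _ WH)//|le].
have -> : [set x in pts W | (f x \notin H) && all (fun H => f x \notin H) Hs] =
    A :\: pts H.
  by apply/setP => x; rewrite !inE andbCA.
rewrite cardsD natrB ?subset_leq_card ?subsetIl //.
move/negP: AH; rewrite -ltNge exprS -mulrA => AH.
apply: (@le_trans _ _ ((1 - eta) * #|A|%:R)); first lra.
by rewrite ler_wpM2l //; lra.
Qed.

End Structure.

Lemma card_pred_sum (R : realFieldType) (X : finType) (P : pred X) :
  #|[set x | P x]|%:R = \sum_x (P x)%:R :> R.
Proof.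
rewrite -sum1_card natr_sum big_mkcond /=; apply: eq_bigr => x _.
by rewrite inE; case: (P x).
Qed.

(* Cauchy-Schwarz over the coordinates in J other than j; the k-th coordinate,
   on which P does not depend, serves as a second choice of the j-th one. *)
Lemma pair_density (R : realFieldType) (T I : finType) (P : pred {ffun I -> T})
    (J : {set I}) (j k : I) (delta : R) :
    j \in J -> k \notin J -> (forall v v' : {ffun I -> T}, {in J, v =1 v'} -> P v = P v') ->
    0 <= delta -> delta * #|{ffun I -> T}|%:R <= #|[set v | P v]|%:R ->
  delta ^+ 2 * #|{ffun I -> T}|%:R <= #|[set v | P v && P (upd v j (v k))]|%:R.
Proof.
move=> jJ kJ Pext delta0; rewrite !card_pred_sum.
set N : R := #|{ffun I -> T}|%:R; set n : R := #|T|%:R => dens.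
pose a v : R := \sum_z (P (upd v j z))%:R.
have sum_const (h : {ffun I -> T} -> R) :
    \sum_v \sum_(w : T) h v = n * \sum_v h v.
  by rewrite mulr_sumr; apply: eq_bigr => v _; rewrite sumr_const mulr_natl.
have a_upd v y : a (upd v j y) = a v.
  apply: eq_bigr => z _; congr (nat_of_bool (P _))%:R.
  by apply/ffunP => i; rewrite !ffunE; case: eqP.
have sum_a : \sum_v a v = n * \sum_v (P v)%:R.
  by rewrite -sum_const [RHS](sum_upd j); apply: eq_bigr => v _.
have sum_a2 : n * (n * \sum_v (P v && P (upd v j (v k)))%:R) = \sum_v a v ^+ 2.
  rewrite -sum_const [X in _ * X](sum_upd k).
  under eq_bigr => v _.
    rewrite (eq_bigr (fun z => (P v)%:R * (P (upd v j z))%:R)); last first.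
      move=> z _; rewrite upd_same -mulnb natrM; congr ((nat_of_bool _)%:R * (nat_of_bool _)%:R).
        apply: Pext => i iJ.
        by rewrite upd_other //; apply: contraNneq kJ => <-.
      apply: Pext => i iJ; rewrite !ffunE.
      by case: eqP => // _; case: eqP => // ik; rewrite -ik iJ in kJ.
    rewrite -mulr_sumr -/(a v).
  over.
  rewrite -sum_const [LHS](sum_upd j); apply: eq_bigr => v _.
  under eq_bigr do rewrite a_upd.
  by rewrite -mulr_suml expr2.
have [n0|n_neq0] := eqVneq #|T| 0%N.
  have [v|N0] := pickP {ffun I -> T}.
    by have := max_card (pred1 (v j)); rewrite card1 n0.
  by rewrite /N (eq_card0 N0) mulr0 sumr_ge0 // => v _; case: (_ && _).
have n_gt0 : 0 < n by rewrite ltr0n lt0n.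
(* The squares of [a v - delta * n] have a nonnegative sum; the lower bound [delta * n] stands in
   for the mean. *)
have cs : 2 * (delta * n) * \sum_v a v - N * (delta * n) ^+ 2 <= \sum_v a v ^+ 2.
  rewrite -subr_ge0.
  have -> : \sum_v a v ^+ 2 - (2 * (delta * n) * \sum_v a v - N * (delta * n) ^+ 2)
      = \sum_v (a v - delta * n) ^+ 2.
    have -> : N * (delta * n) ^+ 2 = \sum_(v : {ffun I -> T}) (delta * n) ^+ 2.
      by rewrite sumr_const mulr_natl.
    rewrite mulr_sumr opprB addrCA -sumrB -big_split /=.
    by apply: eq_bigr => v _; ring.
  by apply: sumr_ge0 => v _; apply: sqr_ge0.
rewrite -sum_a2 sum_a in cs.
rewrite -(ler_pM2l n_gt0) -(ler_pM2l n_gt0).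
apply: le_trans cs.
have : 0 <= delta * n ^+ 2 * (\sum_v (P v)%:R - delta * N).
  by rewrite mulr_ge0 ?subr_ge0 // mulr_ge0 // exprn_ge0 // ltW.
lra.
Qed.

(* With F1 and F2 the spans over J and over k |: J :\ j, whose sum is the span W
   over k |: J: no removed flat contains both, so a tuple that meets a removed
   flat has a coordinate in one that does not contain F1, or does not contain F2. *)
Lemma structured_step (R : realFieldType) (F : fieldType) (V : vectType F)
    (T I : finType) (f : T -> V) (J : {set I}) (k : I)
    (delta eta eta' zeta c : R) (t : nat) :
    (forall x, f x != 0) -> (1 < #|J|)%N -> k \notin J ->
    0 <= delta -> 0 <= eta -> eta <= 2^-1 -> 0 <= eta' -> eta' <= 1 ->
    (1 - eta') ^+ t <= zeta ->
    #|[set v : {ffun I -> T} | ~~ indep f setT v]|%:R <= c * #|{ffun I -> T}|%:R ->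
    4 * #|I|%:R * t%:R * eta + #|I|%:R ^+ 2 * zeta + c <= delta ^+ 2 / 2 ->
  structured f J delta eta -> structured f (k |: J) (delta ^+ 2 / 2) eta'.
Proof.
move=> f0 J2 kJ delta0 eta0 eta_half eta'0 eta'1 zetaE dep small [U [Upts Uthin dens]].
set N : R := #|{ffun I -> T}|%:R in dep dens *.
have [j jJ] : exists j, j \in J by apply/card_gt0P; rewrite ltnW.
(* A coordinate common to [J] and [J1]: it witnesses the hit when a removed flat contains one of the
   two spans. *)
have [j' j'J] : exists j', j' \in J :\ j.
  by apply/card_gt0P; move: J2; rewrite (cardsD1 j) jJ.
set J1 := k |: J :\ j; set J2' := k |: J.
have kJj : k \notin J :\ j by rewrite inE negb_and kJ orbT.
have framedE v : framed f U J (upd v j (v k)) = framed f U J1 v.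
  have spE : sp f J (upd v j (v k)) = sp f J1 v.
    by rewrite (sp_setD1 _ _ jJ) upd_same sp_upd_out ?inE ?eqxx // sp_setU1.
  have cardE : #|J1| = #|J| by rewrite cardsU1 kJj [in RHS](cardsD1 j) jJ.
  rewrite /framed /indep spE cardE; congr (_ && _).
  apply/forall_inP/forall_inP => H i.
    rewrite !inE => /predU1P[->|/andP[ij iJ]]; first by have := H _ jJ; rewrite upd_same.
    by have := H _ iJ; rewrite upd_other.
  move=> iJ; have [->|ij] := eqVneq i j; first by rewrite upd_same H // !inE eqxx.
  by rewrite upd_other // H // !inE ij iJ orbT.
have /(@pair_density R T I _ J j k delta jJ kJ) := dens.
move=> /(_ _ delta0) Qdens.
have {}Qdens : delta ^+ 2 * N <= #|[set v | framed f U J v && framed f U J1 v]|%:R.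
  have -> : [set v | framed f U J v && framed f U J1 v] =
     [set v | framed f U J v && framed f U J (upd v j (v k))].
    by apply/setP => v; rewrite !inE framedE.
  apply: Qdens => v v' vv'; rewrite /framed /indep (eq_sp _ vv'); congr (_ && _).
  by apply: eq_forallb_in => i iJ; rewrite vv'.
have [Hs HsP] := choice (fun W => @prune R F V T f eta' W t eta'0 eta'1).
pose raw W := [set x in pts f W | all (fun H : {vspace V} => f x \notin H) (Hs W)].
(* Where pruning does not end in a thin set, [U'] is empty, which is trivially thin. *)
pose U' W := if `[< thin f eta' W (raw W) >] then raw W else set0.
have raw_pts W : raw W \subset pts f W by apply/subsetP => x; rewrite inE => /andP[].
exists U'; split=> [W|W|].
- by rewrite /U'; case: ifP => _; rewrite ?sub0set.
- rewrite /U'; case: ifPn => [/asboolP //|_] H _.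
  by rewrite set0I cards0 mulr0.
have size_Hs W : (size (Hs W) <= t)%N by case: (HsP W).
have zeta0 : 0 <= zeta by apply: le_trans zetaE; rewrite exprn_ge0 // subr_ge0.
have JJ2 : J \subset J2' by apply: subsetU1.
have J12 : J1 \subset J2' by rewrite setUS // subD1set.
have hits1 := few_hits JJ2 eta0 eta_half Uthin Upts size_Hs.
have hits2 := few_hits J12 eta0 eta_half Uthin Upts size_Hs.
have J20 : J2' != set0 by apply/set0Pn; exists k; rewrite !inE eqxx.
have shr := few_shrunk f0 J20 zeta0 raw_pts.
have cover : [set v | framed f U J v && framed f U J1 v] \subset
    [set v | framed f U' J2' v] :|:
    ([set v : {ffun I -> T} | ~~ indep f setT v] :|:
     ([set v | [&& indep f J2' v, framed f U J v &
      has (fun H : {vspace V} => ~~ (sp f J v <= H)%VS && [exists j in J, f (v j) \in H])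
          (Hs (sp f J2' v))]] :|:
     ([set v | [&& indep f J2' v, framed f U J1 v &
      has (fun H : {vspace V} => ~~ (sp f J1 v <= H)%VS && [exists j in J1, f (v j) \in H])
          (Hs (sp f J2' v))]] :|:
      [set v | framed f raw J2' v &
      #|raw (sp f J2' v)|%:R <= zeta * #|pts f (sp f J2' v)|%:R]))).
  apply/subsetP => v; rewrite in_set => /andP[fr fr1].
  rewrite in_setU in_set; case: (boolP (framed f U' J2' v)) => //= nfr.
  rewrite in_setU in_set; case: (boolP (indep f setT v)) => //= ind.
  have {}ind : indep f J2' v by apply: indepS ind; apply: subsetT.
  rewrite in_setU in_set ind fr /= in_setU in_set ind fr1 /= in_set.
  have [raw_v|] := boolP [forall i in J2', v i \in raw (sp f J2' v)].
    rewrite {1}/framed ind raw_v /=; apply/orP; right; apply/orP; right.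
    have [_ _ [thinW|le]] := HsP (sp f J2' v).
      by case/negP: nfr; rewrite /framed ind /U' asboolT.
    by apply: le_trans le _; rewrite ler_wpM2r ?ler0n.
  (* The coordinate lies in the span, so it can be missing from [raw] only by lying in a removed
     flat [H]. *)
  rewrite negb_forall_in => /exists_inP[i iJ2].
  rewrite inE negb_and inE mem_sp //= => /allPn[H HH]; rewrite negbK => fiH.
  have WH : ~~ (sp f J2' v <= H)%VS by have [_ /allP/(_ _ HH)] := HsP (sp f J2' v).
  have J2E : sp f J2' v = (<[f (v k)]> + sp f J v)%VS by rewrite sp_setU1.
  have kJ1 : k \in J1 by rewrite !inE eqxx.
  have j'J1 : j' \in J1 by rewrite inE j'J orbT.
  have j'J' : j' \in J by move: j'J; rewrite inE => /andP[].
  have [JH|JH] := boolP (sp f J v <= H)%VS.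
    apply/orP; right; apply/orP; left; apply/hasP; exists H => //.
    apply/andP; split.
      apply: contra WH => J1H; rewrite J2E subv_add JH andbT -memvE.
      by apply: (subvP J1H); apply: mem_sp.
    by apply/exists_inP; exists j' => //; apply: (subvP JH); apply: mem_sp.
  have [J1H|J1H] := boolP (sp f J1 v <= H)%VS.
    apply/orP; left; apply/hasP; exists H; rewrite // JH.
    by apply/exists_inP; exists j' => //; apply: (subvP J1H); apply: mem_sp.
  have [iJ|iJ] := boolP (i \in J).
    apply/orP; left; apply/hasP; exists H; rewrite // JH.
    by apply/exists_inP; exists i.
  apply/orP; right; apply/orP; left; apply/hasP; exists H; rewrite // J1H.
  apply/exists_inP; exists i => //; move: iJ2 iJ; rewrite !inE.
  by case: (i == k) => //= ->.
have N0 : 0 <= N by apply: ler0n.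
have bnd (K : {set I}) : #|K|%:R <= #|I|%:R :> R by rewrite ler_nat max_card.
have hits_bnd (K : {set I}) :
    #|K|%:R * (2 * t%:R * eta * N) <= #|I|%:R * (2 * t%:R * eta * N).
  by rewrite ler_wpM2r // !mulr_ge0.
have shr_bnd : #|J2'|%:R * (#|J2'|%:R * (zeta * N)) <= #|I|%:R * (#|I|%:R * (zeta * N)).
  by rewrite ler_pM ?mulr_ge0 ?ler0n ?bnd // ler_pM ?mulr_ge0 ?ler0n ?bnd.
have := card_cover2 cover (lexx _) (card_cover2 (subxx _) dep
  (card_cover2 (subxx _) (le_trans hits1 (hits_bnd _)) (card_cover2 (subxx _)
    (le_trans hits2 (hits_bnd _)) (le_trans shr shr_bnd)))).
move: (ler_wpM2r N0 small); rewrite -!/N -/J2'.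
move: Qdens; rewrite -/N; set x := #|_|%:R; set y := #|[set v | framed f U' J2' v]|%:R.
lra.
Qed.

(** * Passing to smaller flats that are rich in points *)

Section Descent.
Variables (R : realFieldType) (F : fieldType) (V : vectType F) (T I : finType).
Variable f : T -> V.
Hypothesis T_gt0 : (0 < #|{ffun I -> T}|)%N.
Implicit Types (v : {ffun I -> T}) (J : {set I}) (W H : {vspace V}).

Local Notation N := (#|{ffun I -> T}|%:R : R).

Definition rich J (delta M : R) :=
  delta * N <= #|[set v | indep f J v & M <= #|pts f (sp f J v)|%:R]|%:R.

Lemma card_halves (X : finType) (A : {set X}) (P : pred X) (x : R) :
  x <= #|A|%:R -> x / 2 <= #|[set y in A | P y]|%:R \/
                  x / 2 <= #|[set y in A | ~~ P y]|%:R.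
Proof.
move=> xA; have [|lt] := lerP (x / 2) #|[set y in A | P y]|%:R; first by left.
right; move: xA; rewrite -(cardsID [set y | P y] A) natrD.
have -> : A :&: [set y | P y] = [set y in A | P y] by apply/setP => y; rewrite !inE.
have -> : A :\: [set y | P y] = [set y in A | ~~ P y].
  by apply/setP => y; rewrite !inE andbC.
lra.
Qed.

(* One coordinate at a time is moved into the flat that dominates the span; the
   process stops when the coordinates already moved span half of that flat. *)
Lemma rich_descent J (delta eta M : R) :
    J != set0 -> 0 < delta -> 0 < eta -> eta <= 1 -> 0 <= M -> rich J delta M ->
  structured f J (delta / 2) eta \/
  exists2 J1 : {set I}, J1 \proper J &
    rich J1 (delta / 4 * (eta / (4 * #|I|%:R ^+ 2)) ^+ #|I|) (eta * M / 2).
Proof.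
(* [kappa] is the density lost per moved coordinate: [1 / (2 * m)] for choosing the coordinate and
   [eta / (2 * m)] for its new values. *)
set m : R := #|I|%:R; set kappa := eta / _.
move=> J0 delta0 eta0 eta1 M0 dens.
have m1 : 1 <= m.
  rewrite ler1n; apply: leq_trans (max_card (mem J)).
  by rewrite card_gt0.
have m0 : 0 < m by lra.
(* [H0 W] holds more than a share [eta] of the points of [W] if these are not thin, and is arbitrary
   otherwise. *)
have /choice[H0 H0P] : forall W, exists H, ~ thin f eta W (pts f W) ->
    ~~ (W <= H)%VS /\ eta * #|pts f W|%:R < #|pts f W :&: pts f H|%:R.
  move=> W; have [|/existsNP[H /not_implyP[WH /negP lt]]] :=
    pselect (thin f eta W (pts f W)); first by exists W.
  by exists H => _; split => //; rewrite ltNge.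
pose good v := indep f J v && (M <= #|pts f (sp f J v)|%:R).
have [thick|thick] := @card_halves _ _
    (fun v => `[< thin f eta (sp f J v) (pts f (sp f J v)) >]) _ dens.
  left; exists (fun W => if `[< thin f eta W (pts f W) >] then pts f W else set0).
  split=> [W|W|].
  - by case: ifP => _; rewrite ?sub0set.
  - by case: ifPn => [/asboolP //|_] H _; rewrite set0I cards0 mulr0.
  have -> : delta / 2 * N = delta * N / 2 by ring.
  apply: le_trans thick _; rewrite ler_nat; apply: subset_leq_card.
  apply/subsetP => v; rewrite !inE -andbA => /and3P[ind _ th].
  apply/framedP; split=> // j jJ; rewrite th.
  by rewrite inE mem_sp.
right; pose A J1 := [set v | [&& good v,
  ~~ `[< thin f eta (sp f J v) (pts f (sp f J v)) >] &
  [forall j in J1, f (v j) \in H0 (sp f J v)]]].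
have {thick} dens0 : delta / 2 * N <= #|A set0|%:R.
  have -> : delta / 2 * N = delta * N / 2 by ring.
  apply: le_trans thick _; rewrite ler_nat; apply: subset_leq_card.
  apply/subsetP => v; rewrite !inE => /andP[gv tv]; rewrite /good gv tv /=.
  by apply/forall_inP => j; rewrite inE.
have kappa0 : 0 < kappa by rewrite divr_gt0 // mulr_gt0 // exprn_gt0.
have kappa1 : kappa <= 1.
  rewrite ler_pdivrMr ?mul1r ?mulr_gt0 ?exprn_gt0 //.
  have : 1 <= m ^+ 2 by rewrite exprn_ege1.
  lra.
have N0 : 0 < N by rewrite ltr0n.
suff ind (l : nat) (J1 : {set I}) (a : R) : (#|J :\: J1| <= l)%N -> J1 \subset J ->
    0 < a -> a * N <= #|A J1|%:R ->
    exists2 J1 : {set I}, J1 \proper J & rich J1 (a / 2 * kappa ^+ l) (eta * M / 2).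
  have := ind #|I| set0 (delta / 2) (max_card _) (sub0set _) _ dens0.
  by have -> : delta / 4 = delta / 2 / 2; [lra|apply; lra].
elim: l => [|l IH] in J1 a *; move=> cardJ1 J1J a0 densA.
(* Moving all of [J] into [H0] would put the whole span there, while [H0] does not contain it. *)
all: have J1p : J1 \proper J.
1,3: rewrite properE J1J /=; apply/negP => JJ1.
1,2: have : 0 < #|A J1|%:R :> R by apply: lt_le_trans densA; rewrite mulr_gt0.
1,2: rewrite ltr0n => /card_gt0P[v]; rewrite inE => /and3P[_ /asboolP th /forall_inP vH].
1,2: by have [/negP[]] := H0P _ th; apply: sp_subv => j /(subsetP JJ1)/vH.
  by move: J1p; rewrite properE => /andP[_]; rewrite -setD_eq0 -cards_eq0 -leqn0 cardJ1.
pose Hp v := pts f (sp f J v) :&: pts f (H0 (sp f J v)).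
(* Either the moved coordinates often span half of [Hp], so that [J1] is rich, or often half of [Hp]
   lies outside their span and each such point can be exchanged for some coordinate [k] outside
   [J1]. *)
have [rich1|poor] := @card_halves _ _
    (fun v => #|Hp v|%:R / 2 <= #|pts f (sp f J1 v)|%:R :> R) _ densA.
  exists J1 => //; rewrite /rich.
  apply: (@le_trans _ _ (a * N / 2)).
    have : kappa ^+ l.+1 <= 1 by rewrite exprn_ile1 // ltW.
    have : 0 <= a * N by rewrite mulr_ge0 ?ler0n // ltW.
    nra.
  apply: le_trans rich1 _; rewrite ler_nat; apply: subset_leq_card.
  apply/subsetP => v; rewrite !inE => /andP[/and3P[/andP[indv Mv] /asboolP th _] le].
  rewrite (indepS J1J indv) /=; apply: le_trans le.
  have [_] := H0P _ th; rewrite -/(Hp v).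
  have : eta * M <= eta * #|pts f (sp f J v)|%:R by rewrite ler_pM2l.
  lra.
pose E k v := [set w in Hp v | indep f J (upd v k w)].
pose Ak k := [set v in A J1 | #|Hp v|%:R <= 2 * m * #|E k v|%:R].
have [k kJ densk] : exists2 k, k \in J :\: J1 & a / (2 * m) * N <= #|Ak k|%:R.
  apply/exists_inP; apply: contraT; rewrite negb_exists_in => /forall_inP lt.
  have [k0 k0J] : exists k, k \in J :\: J1.
    apply/set0Pn; move: J1p; rewrite properE => /andP[_]; apply: contra.
    by rewrite setD_eq0.
  have cJ : 0 < #|J :\: J1|%:R :> R.
    by rewrite ltr0n; apply/card_gt0P; exists k0.
  suff : a * N / 2 < a * N / 2 by rewrite ltxx.
  apply: le_lt_trans poor _.
  have : (\sum_(k in J :\: J1) #|Ak k|%:R < m * (a / (2 * m) * N) :> R).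
    apply: (@lt_le_trans _ _ (\sum_(k in J :\: J1) a / (2 * m) * N)).
      apply: ltr_sum => [|k /lt]; last by rewrite -ltNge.
      by apply/hasP; exists k0; rewrite ?mem_index_enum.
    rewrite sumr_const -[_ *+ #|J :\: J1|]mulr_natl.
    apply: ler_wpM2r; last by rewrite ler_nat max_card.
    by rewrite mulr_ge0 ?ler0n // divr_ge0 ?mulr_ge0 // ltW.
  have -> : m * (a / (2 * m) * N) = a * N / 2 by field; lra.
  apply: le_lt_trans.
  rewrite -natr_sum ler_nat.
  apply: leq_trans (card_bigcup_le _ _).
  apply: subset_leq_card; apply/subsetP => v.
  rewrite inE -ltNge => /andP[vA small].
  have [/exists_inP[k kJ le]|] := boolP [exists k in J :\: J1,
      #|Hp v|%:R <= 2 * m * #|E k v|%:R].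
    by apply/bigcupP; exists k => //; rewrite inE vA.
  rewrite negb_exists_in => /forall_inP bad; exfalso.
  have := @card_cover R _ _ (Hp v :\: pts f (sp f J1 v)) (J :\: J1) (E^~ v)
     (#|Hp v|%:R / (2 * m)).
  have cov w : w \in Hp v :\: pts f (sp f J1 v) ->
      exists2 k, k \in J :\: J1 & w \in E k v.
    rewrite !inE => /and3P[nw wJ wH].
    move: vA; rewrite inE => /and3P[/andP[indv _] _ _].
    have [k kJ indk] := exchange J1J indv wJ nw.
    by exists k => //; rewrite !inE wJ indk wH.
  move=> /(_ cov) card_le.
  have {card_le} : #|Hp v :\: pts f (sp f J1 v)|%:R <= #|J :\: J1|%:R * (#|Hp v|%:R / (2 * m)).
    apply: card_le => k /bad; rewrite -ltNge => lt_k.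
    by rewrite ler_pdivlMr ?mulr_gt0 // mulrC ltW.
  have : #|J :\: J1|%:R * (#|Hp v|%:R / (2 * m)) <= m * (#|Hp v|%:R / (2 * m)).
    by rewrite ler_wpM2r ?ler_nat ?max_card // divr_ge0 ?mulr_ge0 ?ler0n // ltW.
  have -> : m * (#|Hp v|%:R / (2 * m)) = #|Hp v|%:R / 2 by field; lra.
  have := cardsID (pts f (sp f J1 v)) (Hp v).
  move/(congr1 (fun x => x%:R : R)); rewrite natrD.
  have : #|Hp v :&: pts f (sp f J1 v)|%:R <= #|pts f (sp f J1 v)|%:R :> R.
    by rewrite ler_nat subset_leq_card // subsetIr.
  lra.
have kJ' : k \in J by move: kJ; rewrite inE => /andP[].
have kJ1 : k \notin J1 by move: kJ; rewrite inE => /andP[].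
have densA' : a * kappa * N <= #|A (k |: J1)|%:R.
  have inv v w : indep f J v -> w \in E k v -> sp f J (upd v k w) = sp f J v.
    move=> indv; rewrite !inE => /andP[/andP[wJ _] indw]; exact: upd_indep.
  have := @resample T I R (Ak k) (A (k |: J1)) k (E k)
    (fun v => #|pts f (sp f J v)|) (eta / (2 * m)) 1 ler01.
  rewrite mul1r => res.
  apply: (@le_trans _ _ (eta / (2 * m) * #|Ak k|%:R)).
    apply: (@le_trans _ _ (eta / (2 * m) * (a / (2 * m) * N))).
      by rewrite le_eqVlt; apply/orP; left; apply/eqP; rewrite /kappa; field; lra.
    by rewrite ler_pM2l // divr_gt0 // mulr_gt0.
  apply: res => [v|v w|v _].
  - rewrite inE => /andP[]; rewrite inE => /and3P[/andP[indv _] /asboolP th _] le.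
    split; first by apply/card_gt0P; exists (v k); rewrite inE mem_sp.
    have [_] := H0P _ th; rewrite -/(Hp v) => lt.
    rewrite mulrAC ler_pdivrMr ?mulr_gt0 // [_ * (2 * m)]mulrC.
    exact: le_trans (ltW lt) le.
  - rewrite inE => /andP[]; rewrite inE => /and3P[/andP[indv Mv] th /forall_inP vH] _ wE.
    have spE := inv _ _ indv wE; split; last by rewrite spE.
    rewrite inE /good spE Mv th !andbT; apply/andP; split.
      by move: wE; rewrite inE => /andP[].
    apply/forall_inP => i; rewrite in_setU1 => /predU1P[->|iJ1].
      by move: wE; rewrite upd_same !inE => /andP[/andP[]].
    by rewrite upd_other ?vH //; apply: contraNneq kJ1 => <-.
  - rewrite mul1r ler_nat; apply: subset_leq_card; apply/subsetP => w.
    rewrite inE inE => /andP[/andP[]]; rewrite inE => /and3P[/andP[indv _] _ _] _ vE.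
    have := inv _ _ indv vE; rewrite updK => ->.
    by rewrite inE -[X in f X](upd_same v k w) mem_sp.
have [|||J1' J1'p dens'] := IH (k |: J1) (a * kappa) _ _ _ densA'.
- move: cardJ1; rewrite (cardsD1 k (J :\: J1)) kJ add1n ltnS.
  by rewrite setDDl setUC.
- by rewrite subUset sub1set kJ'.
- by rewrite mulr_gt0.
exists J1' => //; move: dens'; rewrite exprS.
by have -> : a * kappa / 2 * kappa ^+ l = a / 2 * (kappa * kappa ^+ l) by ring.
Qed.

End Descent.

(** * Hyperplanes with few points *)

Section Hyperplanes.
Variables (F : finFieldType) (T I : finType) (f : T -> 'rV[F]_#|I|.+1).
Implicit Types (v : {ffun I -> T}) (w : 'cV[F]_#|I|.+1).

Lemma annihilator v : exists2 w : 'cV[F]_#|I|.+1, w != 0 & forall i, f (v i) *m w = 0.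
Proof.
pose M : 'M_(#|I|, #|I|.+1) := \matrix_(i < #|I|) f (v (enum_val i)).
have : cokermx M != 0.
  by rewrite -mxrank_eq0 mxrank_coker subn_eq0 -ltnNge ltnS rank_leq_row.
move/matrix0Pn => [i [j ij]]; exists (col j (cokermx M)).
  by apply/matrix0Pn; exists i, 0; rewrite mxE.
move=> k; have -> : f (v k) = row (enum_rank k) M by rewrite rowK enum_rankK.
by rewrite -row_mul colE mulmxA mulmx_coker mul0mx row0.
Qed.

(** The span has dimension [#|I|], and the kernel of a nonzero functional in dimension [#|I| + 1]
    has no more. *)
Lemma annihilator_span w v : w != 0 -> indep f setT v ->
  (forall i, f (v i) *m w = 0) -> sp f setT v = lker (linfun (mulmxr w)).
Proof.
move=> w0 ind vw; set phi : 'Hom('rV[F]_#|I|.+1, 'M[F]_1) := linfun (mulmxr w).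
apply/eqP; rewrite eqEdim; apply/andP; split.
  by apply: sp_subv => i _; rewrite memv_ker lfunE /= vw.
rewrite (eqP ind) cardsT.
have := limg_ker_dim phi fullv.
rewrite capfv dimvf /dim /= mul1n => dimE.
suff : limg phi != 0%VS.
  rewrite -dimv_eq0 -lt0n => lim0; rewrite -ltnS; apply: leq_trans (eq_leq dimE).
  by rewrite -addn1 leq_add2l.
move/matrix0Pn: w0 => [i [j wij]]; apply: contraNneq wij => lim0.
have : phi (delta_mx 0 i) \in limg phi by rewrite memv_img ?memvf.
rewrite lim0 memv0 lfunE /= -rowE => /eqP/rowP/(_ j).
by rewrite !mxE => ->.
Qed.

(* Each of the #|F| - 1 multiples of a normal vector of the span of v determines
   that span, so a vector is counted for at most x ^ #|I| tuples. *)
Lemma few_light (R : realFieldType) (U : {vspace 'rV[F]_#|I|.+1} -> {set T}) (x : R) :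
    0 <= x ->
  #|[set v : {ffun I -> T} | framed f U setT v & #|U (sp f setT v)|%:R <= x]|%:R <=
     2 * #|F|%:R ^+ #|I| * x ^+ #|I|.
Proof.
move=> x0; set A := [set v | _].
pose ann (v : {ffun I -> T}) (w : 'cV[F]_#|I|.+1) := (w != 0) && [forall i, f (v i) *m w == 0].
have many v : (#|F|.-1 <= #|[set w | ann v w]|)%N.
  have [w w0 vw] := annihilator v.
  have <- : #|[set a *: w | a : F & a != 0]| = #|F|.-1.
    rewrite card_in_imset => [|a b _ _ /eqP].
      by rewrite -(cardC1 (0 : F)); apply: eq_card => a; rewrite !inE.
    by rewrite -subr_eq0 -scalerBl scaler_eq0 (negPf w0) orbF subr_eq0 => /eqP.
  apply: subset_leq_card; apply/subsetP => w' /imsetP[a]; rewrite inE => a0 ->.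
  rewrite inE /ann scaler_eq0 negb_or a0 w0; apply/forallP => i.
  by rewrite -scalemxAr vw scaler0.
have fiber w : #|[set v in A | ann v w]|%:R <= x ^+ #|I|.
  have [->|[v0]] := set_0Vmem [set v in A | ann v w].
    by rewrite cards0 exprn_ge0.
  have spE v : v \in [set v in A | ann v w] ->
      sp f setT v = lker (linfun (mulmxr w)).
    rewrite !inE => /andP[/andP[/framedP[ind _] _] /andP[w0 /forallP vw]].
    by apply: annihilator_span => // i; apply/eqP.
  move=> v0A; have := v0A; rewrite !inE (spE _ v0A) => /andP[/andP[_ le] _].
  apply: le_trans (lerXn2r _ _ _ le); rewrite ?nnegrE ?ler0n //.
  rewrite -natrX ler_nat -card_ffun_on; apply: subset_leq_card.
  apply/subsetP => v vA; apply/ffun_onP => i; move: (vA); rewrite !inE.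
  by move=> /andP[/andP[/framedP[_ vU] _] _]; rewrite -(spE _ vA) vU.
have dc : (#|F|.-1)%:R * #|A|%:R <= #|F|%:R ^+ #|I|.+1 * x ^+ #|I|.
  apply: (@le_trans _ _ (\sum_(v in A) #|[set w | ann v w]|%:R)).
    rewrite mulrC mulr_natl -sumr_const; apply: ler_sum => v _.
    by rewrite ler_nat.
  have -> : \sum_(v in A) #|[set w | ann v w]|%:R =
      \sum_w #|[set v in A | ann v w]|%:R :> R.
    under eq_bigr do rewrite card_pred_sum.
    rewrite exchange_big /=; apply: eq_bigr => w _.
    rewrite card_pred_sum big_mkcond /=; apply: eq_bigr => v _.
    by case: (v \in A).
  have -> : #|F|%:R ^+ #|I|.+1 = #|{: 'cV[F]_#|I|.+1}|%:R :> R.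
    by rewrite card_mx muln1 natrX.
  by rewrite mulr_natl -sumr_const; apply: ler_sum => w _.
have F2 : (1 < #|F|)%N by rewrite card_finNzRing_gt1.
(* The factor 2 of the bound is [q / (q - 1) <= 2], with [q] the size of the field. *)
have : #|F|%:R <= 2 * (#|F|.-1)%:R :> R.
  by rewrite -natrM ler_nat; lia.
have F0 : 0 < #|F|%:R :> R by rewrite ltr0n ltnW.
move=> F1; rewrite -(ler_pM2l F0); move: dc; rewrite exprS.
have := ler0n R #|A|; nra.
Qed.

End Hyperplanes.

(** * Avoiding a sparse family of sets *)

Section Forbidden.
Variables (R : realFieldType) (T : finType) (G : {set {set T}}).

(** Injectivity on [J] pairs each hit with a member of [G] of size [#|J|], since [G] is bounded size
    by size. *)
Definition hits_forbidden (I : finType) (u : {ffun I -> T}) :=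
  [exists J : {set I}, [&& J != set0, #|u @: J| == #|J| & u @: J \in G]].

Lemma card_imset_eq (I : finType) (J : {set I}) (D : {set T}) :
  (#|[set u : {ffun I -> T} | u @: J == D]| <=
     #|D| ^ #|J| * #|T| ^ (#|I| - #|J|))%N.
Proof.
pose B i : pred T := fun x => (i \in J) ==> (x \in D).
apply: (@leq_trans #|(family B : simpl_pred {ffun I -> T})|).
  apply: subset_leq_card; apply/subsetP => u; rewrite inE => /eqP uJ.
  apply/familyP => i; rewrite /B; apply/implyP => iJ.
  by rewrite -uJ; apply: imset_f.
rewrite card_family foldrE big_image /= (bigID [in J]) /=.
rewrite (eq_bigr (fun=> #|D|)) => [|i iJ]; last first.
  by apply: eq_card => x; rewrite unfold_in /= /B iJ.
rewrite [X in (_ * X)%N](eq_bigr (fun=> #|T|)) => [|i /negPf iJ]; last first.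
  by apply: eq_card => x; rewrite unfold_in /= /B iJ.
rewrite !prod_nat_const leq_mul2l; apply/orP; right.
have -> // : #|[predC J]| = (#|I| - #|J|)%N by rewrite -(cardC [in J]) addKn.
Qed.

Lemma card_hits_at (I : finType) (J : {set I}) :
  (#|[set u : {ffun I -> T} | (#|u @: J| == #|J|) && (u @: J \in G)]| <=
     #|[set D in G | #|D| == #|J|]| * (#|I| ^ #|I| * #|T| ^ (#|I| - #|J|)))%N.
Proof.
set GJ := [set D in G | _].
apply: (@leq_trans (\sum_(D in GJ) #|[set u : {ffun I -> T} | u @: J == D]|)).
  apply: leq_trans (card_bigcup_le _ _).
  apply: subset_leq_card; apply/subsetP => u; rewrite inE => /andP[uJ uG].
  by apply/bigcupP; exists (u @: J); rewrite inE ?uG // eqxx.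
rewrite -sum_nat_const; apply: leq_sum => D; rewrite inE => /andP[_ /eqP DJ].
apply: leq_trans (card_imset_eq _ _) _; rewrite leq_mul2r DJ; apply/orP; right.
have [J0|J0] := posnP #|J|.
  by rewrite J0 expn0; case: #|I| => // k; rewrite expn_gt0.
have JI := max_card (mem J).
apply: (@leq_trans (#|I| ^ #|J|)); first by rewrite leq_exp2r.
by rewrite leq_pexp2l // (leq_trans J0).
Qed.

Lemma card_hits_forbidden (I : finType) (c : R) :
    0 <= c ->
    (forall i, (1 <= i <= #|I|)%N ->
       #|[set D in G | #|D| == i]|%:R <= c * #|T|%:R ^+ i) ->
  #|[set u : {ffun I -> T} | hits_forbidden u]|%:R <=
     2 ^+ #|I| * (#|I|%:R ^+ #|I| * c * #|{ffun I -> T}|%:R).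
Proof.
move=> c0 Gc; pose B (J : {set I}) := if J == set0 then set0 else
  [set u : {ffun I -> T} | (#|u @: J| == #|J|) && (u @: J \in G)].
have -> : 2 ^+ #|I| = #|[set: {set I}]|%:R :> R.
  by rewrite -powersetT card_powerset cardsT natrX.
apply: (@card_cover _ _ _ _ _ B) => [u|J _].
  rewrite inE => /existsP[J /and3P[J0 uJ uG]]; exists J; first by rewrite inE.
  by rewrite /B (negPf J0) inE uJ.
rewrite /B; case: eqVneq => [J0|]; last rewrite -card_gt0 => J0.
  by rewrite cards0 !mulr_ge0 ?exprn_ge0 ?ler0n.
have JI := max_card (mem J).
apply: (@le_trans _ _ (#|[set D in G | #|D| == #|J|]| *
    (#|I| ^ #|I| * #|T| ^ (#|I| - #|J|)))%:R).
  by rewrite ler_nat card_hits_at.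
rewrite card_ffun natrM natrM !natrX.
have -> : #|T|%:R ^+ #|I| = #|T|%:R ^+ #|J| * #|T|%:R ^+ (#|I| - #|J|) :> R.
  by rewrite -exprD subnKC.
have := Gc #|J|; rewrite J0 JI => /(_ isT).
move/(ler_wpM2r (mulr_ge0 (exprn_ge0 #|I| (ler0n R #|I|))
  (exprn_ge0 (#|I| - #|J|) (ler0n R #|T|)))).
move/le_trans; apply; rewrite le_eqVlt; apply/orP; left; apply/eqP; ring.
Qed.

End Forbidden.

(** Overwriting coordinate [i] by an arbitrary point loses nothing, because its old value survives
    at [j]. *)
Lemma card_collision (T I : finType) (i j : I) : i != j ->
  (#|[set u : {ffun I -> T} | u i == u j]| * #|T| <= #|{ffun I -> T}|)%N.
Proof.
move=> ij; rewrite -cardsT -cardsX.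
set A := setX _ _; rewrite -(card_in_imset (f := fun p => upd p.1 i p.2) (D := A)).
  exact: max_card.
move=> [u w] [u' w']; rewrite !inE /= !andbT => /eqP uij /eqP u'ij e.
have ww' : w = w' by rewrite -(upd_same u i w) e upd_same.
have uu' k : k != i -> u k = u' k.
  by move=> ki; rewrite -(upd_other u w ki) e upd_other.
congr pair => //; apply/ffunP => k; have [->|/uu' //] := eqVneq k i.
by rewrite uij u'ij uu' // eq_sym.
Qed.

(** * Completing a tuple to a coplanar set that avoids the sparse family *)

Section Win.
Variables (R : realFieldType) (F : finFieldType) (T I : finType).
Variables (f : T -> 'rV[F]_#|I|.+1) (G : {set {set T}}).
Implicit Types (v : {ffun I -> T}) (w : T) (c delta eta eps : R).

Definition glue v w : {ffun option I -> T} :=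
  [ffun o => if o is Some i then v i else w].

(** When [f] is the homogeneous lift, the dimension bound says that the [#|I| + 1] points lie on an
    affine hyperplane. *)
Definition has_free_coplanar := exists u : {ffun option I -> T},
  [/\ injective u, (\dim (sp f setT u) <= #|I|)%N & ~~ hits_forbidden G u].

(** In the application the sets of full size form the greedy family itself, whose assumed bound
    carries the extra factor [1 / #|F|]. *)
Definition sparse c :=
  (forall i, (1 <= i <= #|I|)%N ->
     #|[set D in G | #|D| == i]|%:R <= c * #|T|%:R ^+ i) /\
  #|[set D in G | #|D| == #|I|.+1]|%:R <= c * #|T|%:R ^+ #|I|.+1 / #|F|%:R.

Local Notation N := (#|{ffun I -> T}|%:R : R).
Local Notation dependent := [set v : {ffun I -> T} | ~~ indep f setT v].

Lemma glue_inj v w v' w' : glue v w = glue v' w' -> v = v' /\ w = w'.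
Proof.
move=> e; split; last by have /ffunP/(_ None) := e; rewrite !ffunE.
by apply/ffunP => i; have /ffunP/(_ (Some i)) := e; rewrite !ffunE.
Qed.

Lemma sparse_top c : 0 <= c -> sparse c ->
  forall i, (1 <= i <= #|{: option I}|)%N ->
    #|[set D in G | #|D| == i]|%:R <= c * #|T|%:R ^+ i.
Proof.
move=> c0 [Gc Gtop] i; rewrite card_option => /andP[i1].
rewrite leq_eqVlt ltnS => /predU1P[->|iI]; last by apply: Gc; rewrite i1.
apply: le_trans Gtop _; rewrite ler_pdivrMr ?ler_peMr ?mulr_ge0 ?exprn_ge0 //.
  by rewrite ler1n ltnW ?card_finNzRing_gt1.
by rewrite ltr0n ltnW ?card_finNzRing_gt1.
Qed.

(** A dependent tuple extended by any point stays coplanar. The two summands bound the proportions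
    of extensions with a repeated point and of those that hit [G]. *)
Lemma win_dependent c c' :
    (0 < #|T|)%N -> 0 <= c -> sparse c ->
    #|I|.+1%:R ^+ 2 / #|T|%:R + (2 * #|I|.+1%:R) ^+ #|I|.+1 * c < c' ->
    c' * N <= #|dependent|%:R ->
  has_free_coplanar.
Proof.
move=> T0 c0 Gc lt_c' dep.
have [//|/forallNP none] := pselect has_free_coplanar.
have n0 : 0 < #|T|%:R :> R by rewrite ltr0n.
have N0 : 0 < N by rewrite ltr0n card_ffun expn_gt0 T0.
have NS : #|{ffun option I -> T}|%:R = #|T|%:R * N.
  by rewrite !card_ffun card_option expnS natrM.
pose D := setX dependent [set: T].
pose coll (p : option I * option I) : {set {ffun option I -> T}} :=
  if p.1 == p.2 then set0 else [set u : {ffun option I -> T} | u p.1 == u p.2].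
have inj : {in D &, injective (fun p => glue p.1 p.2)}.
  by move=> [v w] [v' w'] _ _ /= /glue_inj[-> ->].
have cover : [set glue p.1 p.2 | p in D] \subset
    (\bigcup_(p in [set: option I * option I]) coll p)
    :|: [set u : {ffun option I -> T} | hits_forbidden G u].
  apply/subsetP => u /imsetP[[v w]]; rewrite !inE andbT /= => vdep ->.
  have [hit|nhit] := boolP (hits_forbidden G (glue v w)); first by rewrite orbT.
  rewrite orbF; apply/bigcupP; have := none (glue v w).
  have dimle : (\dim (sp f setT (glue v w)) <= #|I|)%N.
    have le : (sp f setT (glue v w) <= <[f w]> + sp f setT v)%VS.
      apply: sp_subv => -[i|] _; rewrite ffunE.
        by apply: (subvP (addvSr _ _)); apply: mem_sp.
      by apply: (subvP (addvSl _ _)); apply: memv_line.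
    apply: leq_trans (dimvS le) _.
    apply: leq_trans (leq_of_leqif (dimv_add_leqif _ _)) _.
    have lt : (\dim (sp f setT v) < #|I|)%N.
      move: vdep (dim_sp f setT v); rewrite /indep cardsT => ne le'.
      by rewrite ltn_neqAle ne.
    rewrite addnC dim_vline; apply: leq_trans lt.
    by case: (f w != 0); rewrite /= ?addn1 ?addn0.
  have [/injectiveP ginj|] := boolP (injectiveb (glue v w)).
    by case; split.
  move=> /injectivePn[o [o' oo' go]] _; exists (o, o'); first by rewrite inE.
  by rewrite /coll /= (negPf oo') inE go.
have collb : #|\bigcup_(p in [set: option I * option I]) coll p|%:R <=
    #|I|.+1%:R ^+ 2 * N.
  have -> : #|I|.+1%:R ^+ 2 = #|[set: option I * option I]|%:R :> R.
    by rewrite cardsT card_prod card_option natrM expr2.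
  apply: (@card_cover _ _ _ _ _ coll) => [u /bigcupP[p _ up]|p _]; first by exists p.
  rewrite /coll; case: eqVneq => [_|pp]; first by rewrite cards0 ltW.
  rewrite -(ler_pM2r n0) [N * _]mulrC -NS -natrM ler_nat.
  exact: card_collision.
have hitb := card_hits_forbidden c0 (sparse_top c0 Gc).
have := card_cover2 cover collb hitb.
rewrite card_in_imset // cardsX cardsT natrM NS card_option.
move: lt_c'; rewrite -(ltr_pM2r (mulr_gt0 n0 N0)) exprMn => lt_c'.
have := ler_wpM2r (ltW n0) dep.
move: lt_c'; set X := #|I|.+1%:R ^+ 2; set Z := 2 ^+ _; set Y := _%:R ^+ #|I|.+1.
have -> : (X / #|T|%:R + Z * Y * c) * (#|T|%:R * N) =
   X * N + Z * Y * c * (#|T|%:R * N) by field; rewrite lt0r_neq0.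
by lra.
Qed.

Lemma card_dep_pairs (X Y : finType) (A : {set X}) (B : X -> {set Y}) :
  #|[set p | (p.1 \in A) && (p.2 \in B p.1)]|%:R = \sum_(x in A) #|B x|%:R :> R.
Proof.
rewrite card_pred_sum -(pair_big predT predT (fun x y => ((x \in A) && (y \in B x))%:R)) /=.
rewrite [RHS]big_mkcond; apply: eq_bigr => x _.
case: ifP => xA; last by rewrite big1.
by rewrite -card_pred_sum; congr (_%:R); apply: eq_card => y; rewrite inE.
Qed.

Lemma hits_glue v w : ~~ hits_forbidden G v -> hits_forbidden G (glue v w) ->
  (exists k, hits_forbidden G (upd v k w)) \/
  (#|glue v w @: setT| == #|[set: option I]|) && (glue v w @: setT \in G).
Proof.
move=> vG /existsP[J /and3P[J0 cardJ uJ]].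
pose J' := [set i | Some i \in J].
have someJ : Some @: J' \subset J by apply/subsetP => _ /imsetP[i iJ ->]; rewrite inE in iJ.
have gSome i : glue v w (Some i) = v i by rewrite ffunE.
have gNone : glue v w None = w by rewrite ffunE.
have [NJ|NJ] := boolP (None \in J); last first.
  case/negP: vG; apply/existsP; exists J'.
  have JE : J = Some @: J'.
    apply/eqP; rewrite eqEsubset someJ andbT; apply/subsetP => -[i|] iJ.
      by apply: imset_f; rewrite inE.
    by rewrite iJ in NJ.
  have vE : v @: J' = glue v w @: J.
    by rewrite JE -imset_comp; apply: eq_imset => i /=; rewrite gSome.
  rewrite vE (eqP cardJ) uJ andbT; apply/andP; split.
    by apply: contraNneq J0 => J'0; rewrite JE J'0 imset0.
  by rewrite JE card_imset // => i j [].
have [JT|JT] := eqVneq J setT; first by right; rewrite -JT cardJ.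
left; have [[k|] kJ] : exists o, o \notin J.
- apply/existsP; apply: contraR JT; rewrite negb_exists => /forallP all.
  by apply/eqP/setP => o; rewrite inE; have := all o; rewrite negbK.
- exists k; apply/existsP; exists (k |: J').
  have kJ' : k \notin J' by rewrite inE.
  have JE : J = None |: Some @: J'.
    apply/setP => -[i|]; rewrite !inE ?NJ //=.
    by rewrite mem_imset ?inE // => i' j' [].
  have vE : upd v k w @: (k |: J') = glue v w @: J.
    rewrite JE !imsetU1 gNone upd_same; congr (_ |: _).
    rewrite -imset_comp; apply: eq_in_imset => i iJ /=.
    by rewrite gSome upd_other //; apply: contraNneq kJ' => <-.
  rewrite vE (eqP cardJ) uJ andbT; apply/andP; split.
    by apply/set0Pn; exists k; rewrite !inE eqxx.
  rewrite JE !cardsU1 kJ' card_imset; last by move=> i j [].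
  by have /negPf -> : None \notin [set Some x | x in J']; [apply/imsetP => -[]|].
- by rewrite NJ in kJ.
Qed.

(** Without a free coplanar set, each framed tuple has a small [U], or hits [G], or has a large
    share of [U] blocked by hits of some [upd v k w] or by members of [G] of full size. The
    hypothesis adds up bounds for these classes. *)
Lemma win_structured c delta eta eps :
    (1 < #|I|)%N -> (0 < #|T|)%N -> 0 <= c -> 0 < eps -> eps <= 1 -> #|I|%:R * eta <= 4^-1 ->
    2 * eps + (2 * #|I|%:R) ^+ #|I| * c * (1 + 4 * #|I|%:R ^+ 2) +
      2 * #|I|.+1%:R ^+ #|I|.+1 * c / eps < delta ->
    sparse c -> structured f [set: I] delta eta ->
  has_free_coplanar.
Proof.
move=> I2 T0 c0 eps0 eps1 eta_small small Gc [U [Upts Uthin dens]].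
have [//|/forallNP none] := pselect has_free_coplanar.
set m : R := #|I|%:R in eta_small small *.
set m1 : R := #|I|.+1%:R in small *.
have n0 : 0 < #|T|%:R :> R by rewrite ltr0n.
have q0 : 0 < #|F|%:R :> R by rewrite ltr0n ltnW ?card_finNzRing_gt1.
have N0 : 0 < N by rewrite ltr0n card_ffun expn_gt0 T0.
have NE : N = #|T|%:R ^+ #|I| by rewrite card_ffun natrX.
have m0 : 0 < m by rewrite ltr0n ltnW.
set b : R := (2 * m) ^+ #|I| * c in small *.
have b0 : 0 <= b by rewrite mulr_ge0 // exprn_ge0 // mulr_ge0 // ltW.
pose x : R := eps * #|T|%:R / #|F|%:R.
have x0 : 0 < x by rewrite divr_gt0 // mulr_gt0.
pose Hit := [set v : {ffun I -> T} | hits_forbidden G v].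
have HitE : #|Hit|%:R <= b * N.
  apply: le_trans (card_hits_forbidden c0 Gc.1) _.
  by rewrite /b exprMn !mulrA.
have Light := @few_light F T I f R U x (ltW x0).
set L := [set v | _] in Light.
have {}Light : #|L|%:R <= 2 * eps * N.
  have qx : #|F|%:R * x = eps * #|T|%:R by rewrite /x; field; rewrite lt0r_neq0.
  apply: le_trans Light _; rewrite -!mulrA -exprMn qx exprMn -NE ler_pM2l //.
  by rewrite ler_pM2r // -{2}(expr1 eps) ler_wiXn2l // ?(ltW eps0) ?(ltnW I2).
pose E k v := [set w in U (sp f [set: I] v) |
   indep f setT (upd v k w) && hits_forbidden G (upd v k w)].
pose Etop v := [set w in U (sp f [set: I] v) |
   (#|glue v w @: setT| == #|[set: option I]|) && (glue v w @: setT \in G)].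
pose heavy v := framed f U [set: I] v && (x < #|U (sp f setT v)|%:R).
pose A k := [set v : {ffun I -> T} | heavy v && (#|U (sp f setT v)|%:R <= 4 * m * #|E k v|%:R)].
pose Atop := [set v : {ffun I -> T} | heavy v && (#|U (sp f setT v)|%:R <= 2 * #|Etop v|%:R :> R)].
have cover : [set v : {ffun I -> T} | framed f U setT v] \subset
    L :|: (Hit :|: ((\bigcup_(k in [set: I]) A k) :|: Atop)).
  apply/subsetP => v; rewrite inE => fr.
  rewrite in_setU in_set fr /=; case: leP => //= heavy_v.
  rewrite in_setU in_set; case: (boolP (hits_forbidden G v)) => //= nhit.
  rewrite in_setU orbC in_set /heavy fr heavy_v /=; case: leP => //= top_small.
  have [/existsP[k le]|] := boolP [exists k : I,
      #|U (sp f setT v)|%:R <= 4 * m * #|E k v|%:R].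
    by apply/bigcupP; exists k => //; rewrite inE /heavy fr heavy_v.
  rewrite negb_exists => /forallP lt; exfalso.
  have /framedP[ind vU] := fr.
  set u : R := #|U (sp f setT v)|%:R in heavy_v top_small lt *.
  (* At most a quarter of [U] lies in the [Z k], at most a quarter in the [E k v] and less than half
     in [Etop v], so they cannot cover [U]. *)
  pose Z k := U (sp f setT v) :&: pts f (sp f ([set: I] :\ k) v).
  have cov : U (sp f setT v) \subset (\bigcup_(k in [set: I]) Z k) :|:
      ((\bigcup_(k in [set: I]) E k v) :|: Etop v).
    apply/subsetP => w wU.
    have fw : f w \in sp f setT v by have := subsetP (Upts _) _ wU; rewrite inE.
    rewrite in_setU; case: (boolP (w \in \bigcup_(k in _) Z k)) => //= nZ.
    have fwk k : f w \notin sp f ([set: I] :\ k) v.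
      apply: contra nZ => fwk; apply/bigcupP; exists k => //.
      by rewrite !inE wU fwk.
    have ginj : injective (glue v w).
      have vw i : v i <> w.
        (* A point equal to [v i] lies in the span omitting a different index [k], which exists as
           [1 < #|I|]. *)
        move=> vi; have /set0Pn[k] : [set~ i] != set0.
          by rewrite -card_gt0 cardsC1; case: #|I| I2 => [|[]].
        rewrite !inE => ki; case/negP: (fwk k); rewrite -vi; apply: mem_sp.
        by rewrite !inE eq_sym ki.
      have vinj := indep_inj ind.
      move=> [i|] [j|]; rewrite !ffunE => // e.
      - by rewrite (vinj i j) ?inE.
      - by case: (vw i).
      - by case: (vw j).
    have dimg : (\dim (sp f setT (glue v w)) <= #|I|)%N.
      have := eq_leq (eqP ind); rewrite [X in (_ <= X)%N]cardsT.
      apply: leq_trans; apply: dimvS; apply: sp_subv => -[i|] _.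
        by rewrite ffunE mem_sp.
      by rewrite ffunE.
    have hit : hits_forbidden G (glue v w).
      by apply: contraT => nh; case: (none (glue v w)).
    rewrite in_setU; case: (hits_glue nhit hit) => [[k hk]|top].
      apply/orP; left; apply/bigcupP; exists k => //; rewrite inE wU hk andbT.
      by apply: upd_indep_out; rewrite ?inE.
    by rewrite [X in _ || X]inE wU top orbT.
  have Zle : #|\bigcup_(k in [set: I]) Z k|%:R <= m * (eta * u).
    rewrite /m -cardsT; apply: (@card_cover _ _ _ _ _ Z) => [w /bigcupP[k _ wk]|k _].
      by exists k.
    by apply: Uthin; apply: indep_setD1.
  have Ele : #|\bigcup_(k in [set: I]) E k v|%:R <= m * (u / (4 * m)).
    rewrite /m -cardsT; apply: (@card_cover _ _ _ _ _ (E^~ v)) => [w /bigcupP[k _ wk]|k _].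
      by exists k.
    rewrite cardsT -/m ler_pdivlMr ?mulr_gt0 // mulrC ltW //.
    by have := lt k; rewrite -ltNge.
  have := card_cover2 cov Zle (card_cover2 (subxx _) Ele (lexx _)).
  rewrite -/u; have -> : m * (u / (4 * m)) = u / 4 by field; rewrite lt0r_neq0.
  have : m * eta * u <= 4^-1 * u by rewrite ler_wpM2r // ler0n.
  lra.
have Ale k : #|A k|%:R <= 4 * m * b * N.
  have res := @resample T I R (A k) Hit k (E k) (fun v => #|U (sp f setT v)|)
    (4 * m)^-1 1 ler01.
  have inv v w : indep f setT v -> w \in E k v -> sp f setT (upd v k w) = sp f setT v.
    move=> ind; rewrite inE => /and3P[wU indw _]; apply: upd_indep => //.
    by have := subsetP (Upts _) _ wU; rewrite inE.
  rewrite -mulrA -ler_pdivrMl ?mulr_gt0 //.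
  apply: le_trans (res _ _ _) _; last by rewrite mul1r.
  - move=> v; rewrite inE => /andP[/andP[fr hv] le].
    split; first by rewrite -(ltr0n R) (lt_trans x0).
    by rewrite ler_pdivrMl ?mulr_gt0.
  - move=> v w; rewrite inE => /andP[/andP[/framedP[ind _] _] _] wE.
    by rewrite (inv _ _ ind wE) inE; move: wE; rewrite inE => /and3P[].
  - move=> v _; rewrite mul1r ler_nat; apply: subset_leq_card.
    apply/subsetP => w; rewrite inE inE => /andP[/andP[/andP[/framedP[ind wU] _] _] vE].
    by have := inv _ _ ind vE; rewrite updK => ->; have := wU k; rewrite upd_same inE; apply.
have AUle : #|\bigcup_(k in [set: I]) A k|%:R <= m * (4 * m * b * N).
  rewrite /m -cardsT; apply: (@card_cover _ _ _ _ _ A) => [v /bigcupP[k _ vk]|k _ //].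
    by exists k.
  by rewrite cardsT; apply: Ale.
have Atople : #|Atop|%:R <= 2 * m1 ^+ #|I|.+1 * c / eps * N.
  have top : \sum_(v in Atop) #|Etop v|%:R <=
      c * #|T|%:R ^+ #|I|.+1 / #|F|%:R * m1 ^+ #|I|.+1.
    rewrite -card_dep_pairs.
    set S := [set p | _].
    rewrite -(card_in_imset (f := fun p => glue p.1 p.2) (D := S)); last first.
      by move=> [v w] [v' w'] _ _ /= /glue_inj[-> ->].
    apply: le_trans (ler_wpM2r (exprn_ge0 _ (ler0n _ _)) Gc.2).
    rewrite -natrX -natrM ler_nat.
    have := card_hits_at G [set: option I]; rewrite cardsT card_option subnn expn0 muln1.
    apply: leq_trans; apply: subset_leq_card; apply/subsetP => u /imsetP[[v w]].
    by rewrite inE /= => /andP[_]; rewrite inE => /andP[_ h] ->; rewrite inE -card_option -cardsT.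
  (* Heavy sets have more than [x] points, so the factor [1 / #|F|] in [sparse] cancels against the
     one in [x]. *)
  have : x * #|Atop|%:R <= 2 * \sum_(v in Atop) #|Etop v|%:R.
    rewrite mulr_sumr [leLHS]mulrC [leLHS]mulr_natl -sumr_const.
    apply: ler_sum => v.
    by rewrite inE => /andP[/andP[_ hv] le]; apply: le_trans le; rewrite ltW.
  move/le_trans => /(_ _ (ler_wpM2l (ler0n R 2) top)).
  rewrite mulrC -ler_pdivlMr // => /le_trans; apply.
  rewrite le_eqVlt; apply/orP; left; apply/eqP.
  by rewrite /x NE exprS; field; rewrite !lt0r_neq0.
have := card_cover2 cover Light (card_cover2 (subxx _) HitE
  (card_cover2 (subxx _) AUle Atople)).
rewrite -(ltr_pM2r N0) in small.
move: small dens; set y := 2 * m1 ^+ _ * c / eps.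
lra.
Qed.

End Win.

(** * Choice of the constants along the inductions *)

Lemma geometric_small (R : realType) (eta zeta : R) :
  0 < eta -> eta <= 1 -> 0 < zeta -> exists t : nat, (1 - eta) ^+ t <= zeta.
Proof.
move=> eta0 eta1 zeta0.
(* A product form of Bernoulli's inequality, from [(1 - eta) * (1 + t.+1 * eta) <= 1 + t * eta]. *)
have bern t : (1 - eta) ^+ t * (1 + t%:R * eta) <= 1.
  elim: t => [|t IH]; first by rewrite expr0 mul0r addr0 mul1r.
  apply: le_trans IH; rewrite exprSr -mulrA ler_wpM2l ?exprn_ge0 ?subr_ge0 //.
  rewrite -natr1; have := ler0n R t; nra.
have [t tP] : exists t : nat, 1 / (zeta * eta) < t%:R.
  exists (Num.bound (1 / (zeta * eta))); apply: archi_boundP.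
  by rewrite divr_ge0 // mulr_ge0 ?ltW.
rewrite ltr_pdivrMr ?mulr_gt0 // in tP.
have t0 : 0 <= t%:R * eta by rewrite mulr_ge0 ?ler0n // ltW.
have zt : 1 < zeta * (1 + t%:R * eta) by lra.
exists t.
have := bern t; rewrite -ler_pdivlMr; last by lra.
move/le_trans; apply; rewrite ler_pdivrMr; last by lra.
exact: ltW.
Qed.

(** Smaller [c'] are covered too, because thresholds are later cut down by minima; [a + 1] keeps the
    divisor positive. *)
Lemma small_factor (R : realFieldType) (a b : R) : 0 <= a -> 0 < b ->
  exists2 c, 0 < c & forall c', 0 <= c' -> c' <= c -> a * c' < b.
Proof.
move=> a0 b0; exists (b / (a + 1)); first by rewrite divr_gt0 // ltr_wpDl.
have a1 : 0 < a + 1 by rewrite ltr_wpDl.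
move=> c' c'0; rewrite ler_pdivlMr // => le.
by have [->|] := eqVneq c' 0; [rewrite mulr0 | rewrite neq_lt ltNge c'0 /= => ?; lra].
Qed.

Section Chain.
Variables (R : realType) (I : finType).
Hypothesis I_gt1 : (1 < #|I|)%N.

Lemma sparse_le (F : finFieldType) (T : finType) (G : {set {set T}}) (c c' : R) :
  c <= c' -> @sparse R F T I G c -> @sparse R F T I G c'.
Proof.
move=> cc' [Gi Gtop]; split=> [i iI|].
  by apply: le_trans (Gi i iI) _; rewrite ler_wpM2r ?exprn_ge0 ?ler0n.
by apply: le_trans Gtop _; rewrite !ler_wpM2r ?invr_ge0 ?exprn_ge0 ?ler0n.
Qed.

Definition mostly_independent (F : finFieldType) (T : finType)
    (f : T -> 'rV[F]_#|I|.+1) (c : R) :=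
  #|[set v : {ffun I -> T} | ~~ indep f setT v]|%:R <= c * #|{ffun I -> T}|%:R.

Lemma mostly_independent_le (F : finFieldType) (T : finType) (f : T -> 'rV[F]_#|I|.+1) (c c' : R) :
  c <= c' -> mostly_independent f c -> mostly_independent f c'.
Proof. by move=> cc' /le_trans; apply; rewrite ler_wpM2r. Qed.

(** Induction on the number [l] of coordinates outside [J], by [structured_step]. Constants are
    chosen backwards: [eta'] for the larger rank, then the number [t] of removals, then [eta], all
    before the field. *)
Lemma structured_win (l : nat) (delta : R) : 0 < delta ->
  exists eta c : R, [/\ 0 < eta, eta <= 1, 0 < c &
    forall (F : finFieldType) (T : finType) (f : T -> 'rV[F]_#|I|.+1)
        (G : {set {set T}}) (J : {set I}),
      (forall x, f x != 0) -> (0 < #|T|)%N -> (1 < #|J|)%N -> #|~: J| = l ->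
      @sparse R F T I G c -> mostly_independent f c ->
      structured f J delta eta -> has_free_coplanar f G].
Proof.
have m0 : 0 < #|I|%:R :> R by rewrite ltr0n ltnW.
elim: l delta => [|l IH] delta delta0.
  pose eps := Num.min 1 (delta / 8).
  have eps0 : 0 < eps by rewrite lt_min ltr01 divr_gt0.
  have eps1 : eps <= 1 by rewrite ge_min lexx.
  have eps8 : eps <= delta / 8 by rewrite ge_min lexx orbT.
  pose a : R := (2 * #|I|%:R) ^+ #|I| * (1 + 4 * #|I|%:R ^+ 2) +
    2 * #|I|.+1%:R ^+ #|I|.+1 / eps.
  have a0 : 0 <= a.
    by rewrite addr_ge0 ?divr_ge0 ?mulr_ge0 ?addr_ge0 ?mulr_ge0 ?exprn_ge0 ?mulr_ge0 ?ler0n ?ltW.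
  have [c c0 cP] := small_factor a0 (divr_gt0 delta0 (ltr0n R 2)).
  exists (4 * #|I|%:R)^-1, c; split => //.
  - by rewrite invr_gt0 mulr_gt0.
  - rewrite invf_le1 ?mulr_gt0 // -natrM ler1n muln_gt0 /=; exact: ltnW.
  move=> F T f G J f0 T0 J1 cJ Gc _ st.
  have JT : J = setT.
    apply/setP => i; move/eqP: cJ; rewrite cards_eq0 => /eqP/setP/(_ i).
    by rewrite !inE => /negbFE.
  rewrite JT in st.
  apply: (win_structured I_gt1 T0 (ltW c0) eps0 eps1 _ _ Gc st).
    rewrite invfM mulrCA divff ?mulr1 //; exact: lt0r_neq0.
  have := cP c (ltW c0) (lexx _).
  rewrite /a; set x := (2 * _) ^+ _; set y := _ ^+ #|I|.+1; set z := _ ^+ 2.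
  have -> : 2 * y * c / eps = 2 * y / eps * c by ring.
  have -> : x * c * (1 + 4 * z) = x * (1 + 4 * z) * c by ring.
  lra.
have d2 : 0 < delta ^+ 2 / 2 by rewrite divr_gt0 ?exprn_gt0.
have [eta' [c' [eta'0 eta'1 c'0 win]]] := IH _ d2.
(* Each of the three losses in [structured_step] is kept below [delta ^+ 2 / 8], within the allowed
   [delta ^+ 2 / 2]. *)
have d16 : 0 < delta ^+ 2 / 8 by rewrite divr_gt0 ?exprn_gt0.
have [zeta zeta0 zetaP] := small_factor (exprn_ge0 2 (ltW m0)) d16.
have [t tP] := geometric_small eta'0 eta'1 zeta0.
have tm0 : 0 <= 4 * #|I|%:R * t%:R :> R by rewrite !mulr_ge0 // ler0n.
have [eta eta0 etaP] := small_factor tm0 d16.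
exists (Num.min 2^-1 eta), (Num.min c' (delta ^+ 2 / 8)).
set e := Num.min 2^-1 eta; set c := Num.min c' _.
have e0 : 0 < e by rewrite lt_min eta0 invr_gt0 ltr0n.
have e2 : e <= 2^-1 by rewrite ge_min lexx.
have c0 : 0 < c by rewrite lt_min c'0.
split => //; first lra.
move=> F T f G J f0 T0 J1 cJ Gc fc st.
have [k kJ] : exists k, k \in ~: J by apply/card_gt0P; rewrite cJ.
have cc' : c <= c' by rewrite ge_min lexx.
have kJ' : k \notin J by rewrite inE in kJ.
apply: (win F T f G (k |: J) f0 T0) => //.
- by rewrite cardsU1 kJ' add1n ltnS ltnW.
- move: cJ; rewrite (cardsD1 k (~: J)) kJ add1n => -[<-]; apply: eq_card => i.
  by rewrite !inE negb_or.
- exact: sparse_le cc' Gc.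
- exact: mostly_independent_le cc' fc.
apply: (structured_step f0 J1 kJ' (ltW delta0) (ltW e0) e2 (ltW eta'0) eta'1 tP fc _ st).
have le1 : c <= delta ^+ 2 / 8 by rewrite ge_min lexx orbT.
have := zetaP zeta (ltW zeta0) (lexx _).
have := etaP e (ltW e0) _; rewrite ge_min lexx orbT => /(_ isT).
lra.
Qed.

Lemma rich_le (F : finFieldType) (T : finType) (f : T -> 'rV[F]_#|I|.+1)
    (J : {set I}) (delta M M' : R) :
  M' <= M -> rich f J delta M -> rich f J delta M'.
Proof.
move=> MM' /le_trans; apply; rewrite ler_nat; apply: subset_leq_card.
apply/subsetP => v; rewrite !inE => /andP[-> /=]; exact: le_trans.
Qed.

(** Induction on a bound for [#|J|]: [rich_descent] gives a structured system, settled by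
    [structured_win], or a rich proper subset of [J]. Ranks 0 and 1 are impossible, since such spans
    contain at most one point. *)
Lemma rich_win (l : nat) (delta : R) : 0 < delta ->
  exists M c : R, [/\ 0 <= M, 0 < c &
    forall (F : finFieldType) (T : finType) (f : T -> 'rV[F]_#|I|.+1)
        (G : {set {set T}}) (J : {set I}),
      (forall x, f x != 0) -> (forall x y, f x \in <[f y]>%VS -> x = y) ->
      (0 < #|T|)%N -> (#|J| <= l)%N ->
      @sparse R F T I G c -> mostly_independent f c ->
      rich f J delta M -> has_free_coplanar f G].
Proof.
elim: l delta => [|l IH] delta delta0.
  exists 1, 1; split => // F T f G J f0 _ T0; rewrite leqn0 cards_eq0 => /eqP-> _ _.
  rewrite /rich; set S := [set v | _]; have -> : S = set0.
    apply/setP => v; rewrite !inE sp0; apply/negbTE; rewrite negb_and ler1n -leqNgt.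
    rewrite leqn0 cards_eq0; apply/orP; right; apply/eqP/setP => x.
    by rewrite !inE memv0 (negPf (f0 x)).
  by rewrite cards0 leNgt mulr_gt0 // ltr0n card_ffun expn_gt0 T0.
have d2 : 0 < delta / 2 by rewrite divr_gt0.
have [eta [c1 [eta0 eta1 c10 win]]] := structured_win (#|I| - l.+1) d2.
have m0 : 0 < #|I|%:R :> R by rewrite ltr0n ltnW.
have [M2 [c2 [M20 c20 win2]]] := IH _ delta0.
set delta' := delta / 4 * (eta / (4 * #|I|%:R ^+ 2)) ^+ #|I|.
have delta'0 : 0 < delta'.
  by rewrite mulr_gt0 ?divr_gt0 // exprn_gt0 // divr_gt0 // mulr_gt0 // exprn_gt0.
have [M3 [c3 [M30 c30 win3]]] := IH _ delta'0.
(* The 2 excludes rank one; the last term makes [eta * M / 2] reach [M3] after a descent. *)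
pose M := Num.max 2 (Num.max M2 (2 * M3 / eta)).
pose c := Num.min c1 (Num.min c2 c3).
have M_2 : 2 <= M by rewrite le_max lexx.
have MM2 : M2 <= M by rewrite !le_max lexx orbT.
have MM3 : M3 <= eta * M / 2.
  have : 2 * M3 / eta <= M by rewrite !le_max lexx !orbT.
  rewrite ler_pdivrMr //; lra.
have cc1 : c <= c1 by rewrite ge_min lexx.
have cc2 : c <= c2 by rewrite !ge_min lexx orbT.
have cc3 : c <= c3 by rewrite !ge_min lexx !orbT.
exists M, c; split; first lra.
  by rewrite !lt_min c10 c20.
move=> F T f G J f0 finj T0 Jl Gc fc richJ.
have N0 : (0 < #|{ffun I -> T}|)%N by rewrite card_ffun expn_gt0 T0.
move: Jl; rewrite leq_eqVlt ltnS => /predU1P[Jl|Jl]; last first.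
  apply: (win2 F T f G J) => //; first exact: sparse_le cc2 Gc.
    exact: mostly_independent_le cc2 fc.
  exact: rich_le MM2 richJ.
have J0 : J != set0 by rewrite -card_gt0 Jl.
have M0 : 0 <= M by lra.
have [st|[J1 J1J rich1]] := rich_descent N0 J0 delta0 eta0 eta1 M0 richJ; last first.
  apply: (win3 F T f G J1) => //.
  - by have := proper_card J1J; rewrite Jl.
  - exact: sparse_le cc3 Gc.
  - exact: mostly_independent_le cc3 fc.
  exact: rich_le MM3 rich1.
have [J1|J1] := leqP #|J| 1; last first.
  apply: (win F T f G J) => //.
  - by rewrite -(cardsC J) Jl addKn.
  - exact: sparse_le cc1 Gc.
  - exact: mostly_independent_le cc1 fc.
have /cards1P[j Jj] : #|J| == 1%N by rewrite eqn_leq J1 Jl.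
have : delta * #|{ffun I -> T}|%:R <= 0 :> R.
  apply: le_trans richJ _; rewrite lern0 cards_eq0; apply/eqP/setP => v.
  rewrite !inE; apply/negbTE; rewrite negb_and -ltNge; apply/orP; right.
  apply: lt_le_trans M_2; rewrite (ltr_nat R _ 2) ltnS.
  apply: leq_trans (eq_leq (cards1 (v j))); apply: subset_leq_card; apply/subsetP => x.
  by rewrite !inE Jj /sp big_set1 => /finj ->.
by rewrite leNgt mulr_gt0 // ltr0n.
Qed.

Lemma free_coplanar :
  exists C c : R, [/\ 0 < C, 0 < c &
    forall (F : finFieldType) (T : finType) (f : T -> 'rV[F]_#|I|.+1)
        (G : {set {set T}}),
      (forall x, f x != 0) -> (forall x y, f x \in <[f y]>%VS -> x = y) ->
      C * #|F|%:R <= #|T|%:R -> @sparse R F T I G c -> has_free_coplanar f G].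
Proof.
have [M [c1 [M0 c10 win]]] := rich_win #|I| (divr_gt0 ltr01 (ltr0n R 2)).
pose c' := Num.min c1 8^-1.
have c'0 : 0 < c' by rewrite lt_min c10 invr_gt0 ltr0n.
have c'8 : c' <= 8^-1 by rewrite ge_min lexx orbT.
have b0 : 0 <= (2 * #|I|.+1%:R) ^+ #|I|.+1 :> R by rewrite exprn_ge0 ?mulr_ge0 ?ler0n.
have [c2 c20 c2P] := small_factor b0 (divr_gt0 c'0 (ltr0n R 2)).
pose c := Num.min c1 c2.
have c0 : 0 < c by rewrite lt_min c10.
have cc1 : c <= c1 by rewrite ge_min lexx.
have cc2 : c <= c2 by rewrite ge_min lexx orbT.
(* The first term makes [#|T| / (8 * #|F|)] reach [M]; the second keeps the repeated points in
   [win_dependent] below [c' / 2]. *)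
pose C := 8 * M + 2 * #|I|.+1%:R ^+ 2 / c' + 1.
have X0 : 0 <= 2 * #|I|.+1%:R ^+ 2 / c'.
  by rewrite divr_ge0 ?(ltW c'0) ?mulr_ge0 ?exprn_ge0 ?ler0n.
have C0 : 0 < C by rewrite /C; lra.
exists C, c; split => // F T f G f0 finj CqT Gc.
have q1 : 1 <= #|F|%:R :> R by rewrite ler1n ltnW ?card_finNzRing_gt1.
have CT : C <= #|T|%:R.
  by apply: le_trans CqT; rewrite ler_peMr // ltW.
have n0 : 0 < #|T|%:R :> R by apply: lt_le_trans CT.
have T0 : (0 < #|T|)%N by rewrite -(ltr0n R).
set N : R := #|{ffun I -> T}|%:R.
have N0 : 0 < N by rewrite ltr0n card_ffun expn_gt0 T0.
have [dep|] := lerP (c' * N) #|[set v : {ffun I -> T} | ~~ indep f setT v]|%:R.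
  apply: (win_dependent T0 (ltW c0) Gc _ dep).
  have := c2P c (ltW c0) cc2.
  suff : #|I|.+1%:R ^+ 2 / #|T|%:R <= c' / 2 by lra.
  rewrite ler_pdivrMr //.
  have : 2 * #|I|.+1%:R ^+ 2 / c' <= #|T|%:R by apply: le_trans CT; rewrite /C; lra.
  rewrite ler_pdivrMr //; lra.
move=> indep_most.
apply: (win F T f G setT) => //; rewrite ?cardsT //.
- exact: sparse_le cc1 Gc.
- apply: (@mostly_independent_le _ _ f c'); first by rewrite ge_min lexx.
  exact: ltW.
(* Spans with at most [x] points take at most a quarter of the tuples and dependent tuples at most
   an eighth, which leaves more than half. *)
pose x : R := #|T|%:R / (8 * #|F|%:R).
have q0 : 0 < #|F|%:R :> R by lra.
have x0 : 0 <= x by rewrite divr_ge0 ?ler0n // mulr_ge0.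
have Mx : M <= x.
  rewrite ler_pdivlMr ?mulr_gt0 //; apply: le_trans CqT.
  rewrite mulrA ler_pM2r //; rewrite /C; lra.
have := @few_light F T I f R (pts f) x x0.
have -> : 2 * #|F|%:R ^+ #|I| * x ^+ #|I| = 2 * 8^-1 ^+ #|I| * N.
  rewrite /N card_ffun natrX -!mulrA -!exprMn; congr (_ * (_ ^+ _)).
  by rewrite /x; field; rewrite lt0r_neq0.
have e8 : (8^-1 : R) ^+ #|I| <= 8^-1.
  by rewrite -[leRHS]expr1 ler_wiXn2l ?(ltnW I_gt1) //; lra.
set L := [set v | _] => Light.
rewrite /rich; set S := [set v | _].
have cover : [set: {ffun I -> T}] \subset
   S :|: (L :|: [set v : {ffun I -> T} | ~~ indep f setT v]).
  apply/subsetP => v _; rewrite 2!in_setU.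
  have [ind|dep] := boolP (indep f setT v); last by rewrite [X in _ || (_ || X)]inE dep !orbT.
  have fr : framed f (pts f) setT v.
    by apply/framedP; split=> // j jJ; rewrite inE mem_sp.
  have [le|lt] := lerP #|pts f (sp f setT v)|%:R x.
    by rewrite [X in _ || (X || _)]inE fr le !orbT.
  by rewrite inE ind (le_trans Mx (ltW lt)).
have := card_cover2 cover (lexx _) (card_cover2 (subxx _) Light (ltW indep_most)).
rewrite cardsT -/N; have := ler_wpM2r (ltW N0) e8; have := ler_wpM2r (ltW N0) c'8.
lra.
Qed.

End Chain.

(** * Affine flats and the greedy family *)

Section Lift.
Variables (F : finFieldType) (n : nat).
Implicit Types x y : 'rV[F]_n.

(** Homogeneous coordinates turn affine dependence into linear dependence and distinct points into
    nonproportional vectors. *)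
Definition lift_pt x : 'rV[F]_n.+1 := row_mx (1%:M : 'M_1) x.

Lemma lift_pt_neq0 x : lift_pt x != 0.
Proof.
apply/eqP => /(congr1 (fun A : 'rV_(1 + n) => lsubmx A 0 0)).
by rewrite row_mxKl !mxE eqxx => /eqP; rewrite oner_eq0.
Qed.

Lemma lift_pt_inj x y : lift_pt x \in <[lift_pt y]>%VS -> x = y.
Proof.
move=> /vlineP[a e].
have := congr1 (fun A : 'rV_(1 + n) => lsubmx A 0 0) e.
rewrite (scale_row_mx a (1%:M : 'M_1) y) !row_mxKl !mxE eqxx mulr1 => a1.
have := congr1 (fun A : 'rV_(1 + n) => rsubmx A) e.
by rewrite (scale_row_mx a (1%:M : 'M_1) y) !row_mxKr -a1 scale1r.
Qed.

(** [is_flat] asks for an exact dimension, so a direction space that is too small has to be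
    enlarged. *)
Lemma vspace_extend (V0 : {vspace 'rV[F]_n}) k : (\dim V0 <= k <= n)%N ->
  exists2 V : {vspace 'rV[F]_n}, (V0 <= V)%VS & \dim V = k.
Proof.
move=> /andP[]; elim: k => [|k IH].
  by rewrite leqn0 => /eqP V00 _; exists V0.
rewrite leq_eqVlt ltnS => /predU1P[<- _|le kn]; first by exists V0.
have [V V0V Vk] := IH le (ltnW kn).
have [x xV] : exists x, x \notin V.
  exists (vpick V^C); apply: contraTN kn => xV.
  have : vpick V^C \in (V :&: V^C)%VS by rewrite memv_cap xV memv_pick.
  rewrite capv_compl memv0 vpick0 => VC.
  have := dimv_compl V; rewrite (eqP VC) dimv0 dimvf /dim /= mul1n Vk => /esym/eqP.
  by rewrite subn_eq0 leqNgt.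
exists (V + <[x]>)%VS; first exact: subv_trans V0V (addvSl _ _).
rewrite dimv_disjoint_sum ?Vk ?dim_vline; last first.
  apply/eqP; rewrite -subv0; apply/subvP => y; rewrite memv_cap => /andP[yV].
  move=> /vlineP[a ya]; rewrite memv0; have [a0|a0] := eqVneq a 0.
    by rewrite ya a0 scale0r.
  by case/negP: xV; have := memvZ a^-1 yV; rewrite ya scalerA mulVf // scale1r.
have -> : x != 0 by apply: contraNneq xV => ->; rewrite mem0v.
by rewrite addn1.
Qed.

(** The differences [u o - u o0], with a leading 0, span a part of the lifted span that misses
    [lift_pt (u o0)]. So the direction space has dimension below [n], that is, at most
    [n.+1 - 2]. *)
Lemma coplanar_image (O : finType) (o0 : O) (u : {ffun O -> 'rV[F]_n}) :
    injective u -> #|O| = n.+1 -> (1 < n)%N -> (\dim (sp lift_pt setT u) <= n)%N ->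
  coplanar_set n.+1 [set u o | o : O].
Proof.
move=> uinj cardO n1 dimu; split; first by rewrite card_imset.
pose phi : 'Hom('rV[F]_n, 'rV[F]_n.+1) :=
  linfun (mulmxr (row_mx (0 : 'M[F]_(n, 1)) 1%:M)).
have phiE x : phi x = row_mx (0 : 'M_1) x.
  have := mul_mx_row x (0 : 'M[F]_(n, 1)) 1%:M.
  by rewrite mulmx0 mulmx1 lfunE.
have phiB o : phi (u o - u o0) = lift_pt (u o) - lift_pt (u o0).
  have := add_row_mx (1%:M : 'M[F]_1) (u o) (- 1%:M) (- u o0).
  by rewrite subrr -opp_row_mx phiE => <-.
have ker0 : lker phi == 0%VS.
  rewrite -subv0; apply/subvP => x; rewrite memv_ker memv0 phiE => /eqP.
  move/(congr1 (fun A : 'rV_(1 + n) => rsubmx A)); rewrite row_mxKr => ->.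
  by apply/eqP/rowP => i; rewrite !mxE.
pose V0 := (\sum_(o : O) <[u o - u o0]>)%VS.
have V0W : (phi @: V0 <= sp lift_pt setT u)%VS.
  apply/subvP => _ /memv_imgP[x xV ->].
  have : (V0 <= phi @^-1: sp lift_pt setT u)%VS.
    apply/subv_sumP => o _; rewrite -memvE -memv_preim phiB.
    by rewrite memvB ?mem_sp.
  by move/subvP/(_ _ xV); rewrite -memv_preim.
have nV0 : lift_pt (u o0) \notin (phi @: V0)%VS.
  apply/memv_imgP => -[x _]; rewrite phiE.
  move/(congr1 (fun A : 'rV_(1 + n) => lsubmx A 0 0)); rewrite !row_mxKl !mxE eqxx.
  by move/eqP; rewrite oner_eq0.
have dimV0 : (\dim V0 < n)%N.
  apply: leq_trans dimu.
  have le : (phi @: V0 + <[lift_pt (u o0)]> <= sp lift_pt setT u)%VS.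
    by rewrite subv_add V0W -memvE mem_sp.
  apply: leq_trans (dimvS le); rewrite dimv_disjoint_sum ?dim_vline ?lift_pt_neq0.
    by rewrite limg_dim_eq ?addn1 // (eqP ker0) capv0.
  apply/eqP; rewrite -subv0; apply/subvP => y; rewrite memv_cap => /andP[yV].
  move=> /vlineP[a ya]; rewrite memv0; have [a0|a0] := eqVneq a 0.
    by rewrite ya a0 scale0r.
  by case/negP: nV0; have := memvZ a^-1 yV; rewrite ya scalerA mulVf // scale1r.
have n2 : (n.+1 - 2).+1 = n by lia.
have [|V V0V dimV] := @vspace_extend V0 (n.+1 - 2) _.
  apply/andP; split; last exact: leq_trans (leqnSn _) (eq_leq n2).
  exact: leq_trans dimV0 (eq_leq (esym n2)).
exists [set u o0 + v | v in V]; split; first by exists (u o0), V.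
apply/subsetP => _ /imsetP[o _ ->]; apply/imsetP; exists (u o - u o0).
  apply: (subvP V0V); apply: (subvP (sumv_sup o _ (subvv _))) => //.
  exact: memv_line.
by rewrite addrC subrK.
Qed.
End Lift.

(** * Maximal families with bounded codegrees *)

Section Greedy.
Variables (P : finType) (X : {set P}) (ok : pred {set P}) (d : nat) (b : nat -> nat).

Definition codegree (S : {set {set P}}) (D : {set P}) := #|[set s in S | D \subset s]|.

Definition bounded_codegrees (S : {set {set P}}) :=
  [forall D : {set P}, (0 < #|D| <= d)%N ==> (codegree S D <= b #|D|)%N].

Definition saturated (S : {set {set P}}) :=
  [set D : {set P} | (#|D| <= d)%N && (b #|D| <= codegree S D)%N].

(** Adding [s] raises the codegrees of its subsets by one and no others; if no nonempty subset were
    saturated or in [S], the larger family would still be valid. *)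
Lemma maximal_family : (forall s, ok s -> s != set0) -> exists S : {set {set P}},
  [/\ forall s, s \in S -> ok s, bounded_codegrees S &
      forall s, ok s -> exists D : {set P},
        [/\ D != set0, D \subset s & D \in saturated S :|: S]].
Proof.
move=> ok_neq0; pose valid (S : {set {set P}}) := [forall s in S, ok s] && bounded_codegrees S.
have valid0 : valid set0.
  apply/andP; split; first by apply/forall_inP => s; rewrite inE.
  apply/forall_inP => D _; rewrite /codegree; set A := [set s in _ | _].
  by have -> : A = set0; [apply/setP => s; rewrite !inE | rewrite cards0].
pose S := [arg max_(S > set0 | valid S) #|S|].
have [validS maxS] : valid S /\ forall S', valid S' -> (#|S'| <= #|S|)%N.
  by rewrite /S; case: arg_maxnP.
have /andP[/forall_inP Sok Sb] := validS.
exists S; split => // s oks; apply/not_existsP => none.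
have none' D : D != set0 -> D \subset s -> D \notin saturated S :|: S.
  by move=> D0 Ds; apply/negP => DS; case: (none D).
have sS : s \notin S.
  by have := none' s (ok_neq0 s oks) (subxx s); rewrite inE negb_or => /andP[].
suff /maxS : valid (s |: S) by rewrite cardsU1 sS add1n ltnn.
apply/andP; split.
  by apply/forall_inP => s'; rewrite in_setU1 => /predU1P[->|/Sok].
apply/forall_inP => D /andP[D0 Dd].
have le1 : (codegree (s |: S) D <= (D \subset s) + codegree S D)%N.
  rewrite /codegree; case: (boolP (D \subset s)) => Ds.
    apply: (@leq_trans #|[set s] :|: [set s' in S | D \subset s']|).
      apply: subset_leq_card; apply/subsetP => s'; rewrite !inE.
      by move=> /andP[/orP[-> //|->] ->]; rewrite orbT.
    by apply: leq_trans (leq_of_leqif (leq_card_setU _ _)) _; rewrite cards1.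
  apply: subset_leq_card; apply/subsetP => s'.
  by rewrite !inE => /andP[/predU1P[->|-> -> //]]; rewrite (negPf Ds).
apply: leq_trans le1 _; case: (boolP (D \subset s)) => Ds; last first.
  by have /forall_inP/(_ D) := Sb; apply; rewrite D0.
have := none' D _ Ds; rewrite -card_gt0 => /(_ D0).
by rewrite !inE negb_or Dd /= -ltnNge => /andP[].
Qed.

(** Double count the pairs of a saturated [D] and a member of [S] containing it: a member has
    [2 ^ d.+1] subsets. *)
Lemma card_saturated (S : {set {set P}}) i : (forall s, s \in S -> #|s| = d.+1) ->
  (#|[set D in saturated S | #|D| == i]| * b i <= 2 ^ d.+1 * #|S|)%N.
Proof.
move=> Sd; set A := [set D in _ | _].
apply: (@leq_trans (\sum_(D in A) codegree S D)).
  rewrite -sum_nat_const; apply: leq_sum => D.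
  by rewrite !inE => /andP[/andP[_ le] /eqP <-].
have -> : (\sum_(D in A) codegree S D = \sum_(s in S) #|[set D in A | D \subset s]|)%N.
  transitivity (\sum_(D in A) \sum_(s in S | D \subset s) 1)%N.
    apply: eq_bigr => D _; rewrite sum1dep_card; apply: eq_card => s.
    by rewrite !inE.
  rewrite (exchange_big_dep (fun s => s \in S)) /=; last by move=> D s _ /andP[].
  apply: eq_bigr => s sS; rewrite sum1dep_card; apply: eq_card => D.
  by rewrite !inE sS.
rewrite mulnC -sum_nat_const; apply: leq_sum => s /Sd <-.
rewrite -card_powerset; apply: subset_leq_card; apply/subsetP => D.
by rewrite !inE => /andP[].
Qed.

End Greedy.

(** * From the maximal family to the required bounds *)

Lemma half_divn (R : realFieldType) (a q : nat) :
  (0 < q)%N -> (q <= a)%N -> a%:R <= 2 * q%:R * (a %/ q)%:R :> R.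
Proof.
move=> q0 qa; rewrite -!natrM ler_nat {1}(divn_eq a q).
have := ltn_pmod a q0; have : (0 < a %/ q)%N by rewrite divn_gt0.
nia.
Qed.

Lemma balanced_family (R : realType) (I : finType) : (1 < #|I|)%N ->
  exists2 C : R, 1 <= C &
  forall (F : finFieldType) (X : {set 'rV[F]_#|I|}), C * #|F|%:R <= #|X|%:R ->
  exists S : {set {set 'rV[F]_#|I|}},
    [/\ forall s, s \in S -> s \subset X /\ coplanar_set #|I|.+1 s,
        C^-1 * #|X|%:R ^+ #|I|.+1 / #|F|%:R <= #|S|%:R &
        forall D : {set 'rV[F]_#|I|}, (0 < #|D| <= #|I|)%N ->
          (codegree S D <= #|X| ^ (#|I|.+1 - #|D|) %/ #|F|)%N].
Proof.
set d := #|I|; move=> d1.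
have [C0 [c [C00 c0 free]]] := @free_coplanar R I d1.
have K0 : 0 < 2 ^+ d.+2 / c by rewrite divr_gt0 ?exprn_gt0.
have ci0 : 0 < c^-1 by rewrite invr_gt0.
(* The second and third terms bring the densities [2 ^+ d.+2 / C] of saturated sets and [C^-1] of
   the family below [c]; the 1 gives [q <= n]. *)
pose C := C0 + 2 ^+ d.+2 / c + c^-1 + 1.
have C1 : 1 <= C by rewrite /C; lra.
have C_gt0 : 0 < C by lra.
have CK : 2 ^+ d.+2 / C <= c.
  rewrite ler_pdivrMr // mulrC -ler_pdivrMr //; rewrite /C; lra.
have Cc : C^-1 <= c by rewrite invf_ple ?posrE //; rewrite /C; lra.
exists C => // F X CqX.
set q := #|F| in CqX *; set n := #|X| in CqX *.
have q1 : (0 < q)%N by rewrite ltnW ?card_finNzRing_gt1.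
have q0 : 0 < q%:R :> R by rewrite ltr0n.
have qn : (q <= n)%N.
  by rewrite -(ler_nat R); apply: le_trans CqX; rewrite ler_peMl ?ler0n.
have n0 : 0 < n%:R :> R by rewrite ltr0n (leq_trans q1).
pose ok (s : {set 'rV[F]_d}) := (s \subset X) && `[< coplanar_set d.+1 s >].
have okP s : ok s -> s \subset X /\ coplanar_set d.+1 s by move=> /andP[? /asboolP].
have ok_card s : ok s -> #|s| = d.+1 by move=> /okP[_ []].
have ok_neq0 s : ok s -> s != set0 by move=> /ok_card e; rewrite -card_gt0 e.
pose b i := (n ^ (d.+1 - i) %/ q)%N.
have [S [Sok Sb Smax]] := maximal_family d b ok_neq0.
exists S; split=> [s /Sok/okP //||D Dd]; last first.
  by move/forall_inP: Sb => /(_ D Dd).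
rewrite leNgt; apply/negP => S_small.
pose T : finType := {x | x \in X}.
pose f (t : T) : 'rV[F]_d.+1 := lift_pt (val t).
have cardT : #|T| = n by rewrite card_sig; apply: eq_card.
pose G := [set D : {set T} | val @: D \in saturated d b S :|: S].
have cardG i : (#|[set D in G | #|D| == i]| <=
    #|[set D in saturated d b S :|: S | #|D| == i]|)%N.
  rewrite -(card_imset _ (imset_inj (@val_inj _ _ T))).
  apply: subset_leq_card; apply/subsetP => x /imsetP[D DG ->].
  by move: DG; rewrite !inE (card_imset _ val_inj).
have S_card s : s \in S -> #|s| = d.+1 by move=> /Sok/ok_card.
have sparseG : @sparse R F T I G c.
  split=> [i /andP[i1 id]|].
    apply: le_trans (_ : #|[set D in saturated d b S | #|D| == i]|%:R <= _).
      rewrite ler_nat; apply: leq_trans (cardG i) _; apply: subset_leq_card.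
      apply/subsetP => D; rewrite !inE => /andP[/orP[-> -> //|DS] /eqP Di].
      by move: id; rewrite -Di (S_card _ DS) ltnn.
    have := @card_saturated _ d b S i S_card.
    rewrite -(ler_nat R) !natrM natrX => sat.
    rewrite cardT.
    (* The floor in [b] costs a factor 2, as the power of [n] is at least [q]; with [2 ^ d.+1] from
       [card_saturated] this makes [2 ^+ d.+2]. *)
    have bi : n%:R ^+ (d.+1 - i) <= 2 * q%:R * (b i)%:R :> R.
      have i_lt : (1 <= d.+1 - i)%N by rewrite subn_gt0 ltnS.
      have := leq_pexp2l (leq_trans q1 qn) i_lt; rewrite expn1 => /(leq_trans qn).
      by rewrite -natrX; apply: half_divn.
    set A : R := #|[set D in _ | _]|%:R in sat *.
    have nP : 0 < n%:R ^+ (d.+1 - i) :> R by rewrite exprn_gt0.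
    have A0 : 0 <= A by apply: ler0n.
    rewrite -(ler_pM2r nP) -mulrA -exprD subnKC; last exact: leqW.
    apply: (@le_trans _ _ (2 * q%:R * (A * (b i)%:R))).
      by rewrite [leRHS]mulrCA ler_wpM2l.
    apply: (@le_trans _ _ (2 * q%:R * (2 ^+ d.+1 * #|S|%:R))).
      by rewrite ler_wpM2l // mulr_ge0 // ltW.
    apply: (@le_trans _ _ (2 ^+ d.+2 / C * n%:R ^+ d.+1)); last first.
      by rewrite ler_wpM2r // exprn_ge0 // ltW.
    have := ltW S_small; rewrite ler_pdivlMr // => le.
    have p0 : 0 <= 2 ^+ d.+2 :> R by rewrite exprn_ge0.
    have := ler_wpM2l p0 le; rewrite (exprS 2 d.+1); set y := 2 ^+ d.+1.
    move=> le'; apply: le_trans (_ : _ <= 2 * y * (#|S|%:R * q%:R)) _.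
      by rewrite le_eqVlt; apply/orP; left; apply/eqP; ring.
    by apply: le_trans le' _; rewrite le_eqVlt; apply/orP; left; apply/eqP; ring.
  apply: (@le_trans _ _ #|S|%:R).
    rewrite ler_nat; apply: leq_trans (cardG _) _; apply: subset_leq_card.
    apply/subsetP => D; rewrite !inE => /andP[/orP[/andP[Dd _]|//] /eqP DE].
    by move: Dd; rewrite DE ltnn.
  apply: le_trans (ltW S_small) _; rewrite cardT.
  by rewrite !ler_wpM2r ?invr_ge0 ?exprn_ge0 ?ler0n.
have [||u [uinj udim ufree]] := free F T f G (fun x => lift_pt_neq0 _) _ _ sparseG.
- by move=> x y /lift_pt_inj /val_inj.
- by rewrite cardT; apply: le_trans CqX; rewrite ler_wpM2r // /C; lra.
have uval : injective [ffun o => val (u o)] by move=> o o'; rewrite !ffunE => /val_inj/uinj.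
pose s := [set val (u o) | o : option I].
have oks : ok s.
  apply/andP; split; first by apply/subsetP => _ /imsetP[o _ ->]; apply: valP.
  apply/asboolP; have := coplanar_image None uval.
  rewrite card_option => /(_ erefl d1).
  have -> : sp (@lift_pt F d) [set: option I] [ffun o => val (u o)] = sp f setT u.
    by apply: eq_bigr => o _; rewrite ffunE.
  move=> /(_ udim); congr (coplanar_set _ _).
  by apply: eq_imset => o; rewrite ffunE.
have [D [D0 Ds DG]] := Smax s oks.
case/negP: ufree; apply/existsP; pose J := [set o | val (u o) \in D].
(* The set [D] inside [s] is the image of the indices in [J], so it is a hit of [u]. *)
have DE : D = val @: (u @: J).
  apply/eqP; rewrite eqEsubset; apply/andP; split; apply/subsetP => x.
    move=> xD; have /imsetP[o _ xo] := subsetP Ds _ xD; rewrite xo.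
    by apply/imset_f/imset_f; rewrite inE -xo.
  by move=> /imsetP[_ /imsetP[o oJ ->] ->]; rewrite inE in oJ.
exists J; apply/and3P; split.
- by apply: contraNneq D0 => J0; rewrite DE J0 !imset0.
- by rewrite card_imset.
- by rewrite inE -DE.
Qed.

Theorem theorem1p1 (R : realType) (d : nat) (hd : (2 <= d)%N) :
  exists C : R, 0 < C /\
  exists q0 : nat, forall (q : nat) (F : finFieldType),
    #|F| = q -> (q0 <= q)%N ->
    forall (n : nat) (X : {set 'rV[F]_d}),
      #|X| = n -> C * q%:R <= n%:R ->
      exists S : {set {set 'rV[F]_d}},
        (forall s : {set 'rV[F]_d}, s \in S ->
           s \subset X /\ coplanar_set d.+1 s) /\
        C^-1 * n%:R ^+ d.+1 * (q%:R)^-1 <= #|S|%:R /\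
        (forall j : nat, (1 <= j <= d.+1)%N ->
           (max_codegree X j S)%:R <=
             C * n%:R ^+ (d.+1 - j) *
             (q%:R `^ (- ((d.+1 - j)%N%:R / d%:R)))).
Proof.
have := @balanced_family R 'I_d; rewrite card_ord => /(_ hd)[C C1 fam].
exists C; split; first lra.
(* [balanced_family] is uniform in the field, which allows the threshold 0. *)
exists 0%N => q F Fq _ n X Xn; rewrite -Fq -Xn => CqX.
have [S [Sok Slarge Sb]] := fam F X CqX.
exists S; split=> //; split=> // j /andP[j1 jd].
have q1 : (1 < #|F|)%N by apply: card_finNzRing_gt1.
have q0 : 0 < #|F|%:R :> R by rewrite ltr0n ltnW.
(* For [j = d.+1] a member containing [D] equals [D], so the count is at most [1 <= C]. *)
move: jd; rewrite leq_eqVlt ltnS => /predU1P[->|jd].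
  rewrite subnn mul0r oppr0 powRr0 expr0 !mulr1; apply: le_trans C1.
  rewrite lern1; apply/bigmax_leqP => D /andP[_ /eqP Dd].
  apply: leq_trans (eq_leq (cards1 D)); apply: subset_leq_card; apply/subsetP => s.
  rewrite !inE => /andP[sS Ds]; have [_ [cs _]] := Sok s sS.
  by rewrite eq_sym eqEcard Ds Dd cs leqnn.
apply: (@le_trans _ _ (#|X| ^ (d.+1 - j) %/ #|F|)%:R).
  rewrite ler_nat; apply/bigmax_leqP => D /andP[_ /eqP Dj].
  by have := Sb D; rewrite Dj j1 jd; apply.
apply: (@le_trans _ _ (#|X|%:R ^+ (d.+1 - j) / #|F|%:R)).
  by rewrite ler_pdivlMr // -natrM -natrX ler_nat leq_trunc_div.
rewrite -mulrA; apply: (@le_trans _ _ (1 * (#|X|%:R ^+ (d.+1 - j) / #|F|%:R))).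
  by rewrite mul1r.
rewrite ler_pM ?mulr_ge0 ?invr_ge0 ?exprn_ge0 ?ler0n // ler_wpM2l ?exprn_ge0 //.
(* As [j >= 1], the exponent [(d.+1 - j) / d] is at most 1, so division by [q] is at least as strong
   as the required power. *)
rewrite powRN lef_pV2 ?posrE ?powR_gt0 // -[leRHS]powRr1 ?ler0n //.
apply: ler_powR; first by rewrite ler1n ltnW.
by rewrite ler_pdivrMr ?mul1r ?ler_nat ?ltr0n; lia.
Qed.
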